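(* Let $\alpha\in(0,1)$, $c\ge0$ and $n^*\in\mathbb{N}$. Then there is $N_0=N_0(n^*,\alpha,c)\ge2$ such that the following holds. Let $N\ge N_0$ and let $F_0^N$ be a symmetric Radon probability measure on $S^{N-1}(\sqrt N)$, used as the initial law of the stochastic Kac process. For $n\in\{1,\dots,N\}$ and $t\ge0$ let $\kappa_t^{n,\mathrm{nr}}:=\kappa[e_1(t),e_2(t),\dots,e_n(t)]$ be the non-repeated energy cumulant of order $n$. Let $B\ge1$ be a constant such that $$\max_{1\le n\le n^*}\left(\frac{|\kappa_0^{n,\mathrm{nr}}|\,N^{(\alpha-c)(n-1)}}{(n-1)!}\right)^{1/n}\le B .$$ Then there is a constant $C\ge1$, depending only on $B$, such that for all $n\in\{1,\dots,n^*\}$ and all $t\ge0$, $$N^{\alpha(n-1)}\,|\kappa_t^{n,\mathrm{nr}}|\le C^n\,(n-1)!\,\left(e^{-\frac{n}{4}t}N^{c(n-1)}+1\right).$$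
   Context: Stochastic Kac model. For $N\ge 2$ the state space is the sphere $S^{N-1}(\sqrt N)=\{v\in\mathbb{R}^N: |v|^2=N\}$. For $i\ne j$ and $\theta\in(-\pi,\pi]$, let $R_{i,j}(\theta)$ be the rotation of $\mathbb{R}^N$ with $(R_{i,j}(\theta)v)_i=\cos(\theta)v_i+\sin(\theta)v_j$, $(R_{i,j}(\theta)v)_j=-\sin(\theta)v_i+\cos(\theta)v_j$, and all other components unchanged. Define $(Q_N\phi)(v)=\frac{1}{N(N-1)}\sum_{i\ne j}\int_{-\pi}^{\pi}\frac{d\theta}{2\pi}\phi(R_{i,j}(\theta)v)$. The stochastic Kac process is the Markov jump process $v(t)$ on $S^{N-1}(\sqrt N)$ with generator $N(Q_N-I)$; if its initial law is $F_0^N$, its law $F_t^N$ at time $t\ge0$ satisfies $\frac{d}{dt}\int\phi\,dF_t^N=\int N(Q_N-I)\phi\,dF_t^N$ for all continuous $\phi$. A measure on the sphere is symmetric if it is invariant under all permutations of the coordinates $v_1,\dots,v_N$; symmetry is preserved by the evolution. Energies: $e_i(t)=v_i(t)^2$. The joint cumulant of $e_1(t),\dots,e_n(t)$ is $\kappa[e_1(t),\dots,e_n(t)]=\partial_{\xi_1}\cdots\partial_{\xi_n}\log\int e^{\sum_i\xi_i v_i^2}F_t^N(dv)$ at $\xi=0$. *)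

(* Defs.v *)
From mathcomp Require Import all_boot all_order all_algebra all_fingroup.
From mathcomp Require Import all_classical all_reals all_analysis.

Set Implicit Arguments.
Unset Strict Implicit.
Unset Printing Implicit Defensive.

Import Order.TTheory GRing.Theory Num.Theory.
Import numFieldNormedType.Exports.

Local Open Scope classical_set_scope.
Local Open Scope ring_scope.

(* R^N with its Borel sigma-algebra. Laws on the sphere are represented as
   Borel probability measures on R^N giving mass one to the sphere. *)
Notation borel_rV R N := (g_sigma_algebraType (@open 'rV[R]_N)).

Definition kac_sphere (R : realType) (N : nat) : set 'rV[R]_N :=
  [set v | \sum_(i < N) v 0 i ^+ 2 = N%:R].

Arguments kac_sphere {R} N.

Definition kac_rotation (R : realType) (N : nat) (i j : 'I_N) (theta : R)
    (v : 'rV[R]_N) : 'rV[R]_N :=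
  \row_k (if k == i then cos theta * v 0 i + sin theta * v 0 j
          else if k == j then - sin theta * v 0 i + cos theta * v 0 j
          else v 0 k).

Definition kac_Q (R : realType) (N : nat) (phi : 'rV[R]_N -> R)
    (v : 'rV[R]_N) : R :=
  (N%:R * (N%:R - 1))^-1 *
  \sum_(i < N) \sum_(j < N | i != j)
    \int[lebesgue_measure]_(theta in `[- pi, pi])
      (phi (kac_rotation i j theta v) / (2 * pi)).

Definition kac_generator (R : realType) (N : nat) (phi : 'rV[R]_N -> R)
    (v : 'rV[R]_N) : R :=
  N%:R * (kac_Q phi v - phi v).

(* Derivative at t of a function on the half-line [0, +oo[ : two-sided for
   t > 0 and one-sided at t = 0. *)
Definition has_derivative_halfline (R : realType) (u : R -> R) (t l : R) :=
  (s - t)^-1 * (u s - u t) @[s --> within [set s | 0 <= s] t^'] --> l.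

(* F t, for t >= 0, is the law at time t of the stochastic Kac process with
   initial law F 0. Since the generator N (Q_N - I) is a bounded operator on
   the continuous functions on the sphere, the evolution equation determines
   F t from F 0. Values of phi off the sphere and of F at negative times are
   irrelevant. *)
Definition kac_evolution (R : realType) (N : nat)
    (F : R -> probability (borel_rV R N) R) :=
  (forall t, 0 <= t -> F t (kac_sphere N) = 1%E) /\
  (forall phi : 'rV[R]_N -> R, {within kac_sphere N, continuous phi} ->
   forall t, 0 <= t ->
     has_derivative_halfline
       (fun s => \int[F s]_(v in kac_sphere N) phi v) t
       (\int[F t]_(v in kac_sphere N) kac_generator phi v)).

Definition symmetric_law (R : realType) (N : nat)
    (P : probability (borel_rV R N) R) :=
  forall (s : 'S_N) (A : set (borel_rV R N)), measurable A ->
    P [set v | A (col_perm s v)] = P A.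

Definition radon_measure (R : realType) (N : nat)
    (mu : {measure set (borel_rV R N) -> \bar R}) :=
  (forall K : set 'rV[R]_N, compact K -> (mu K < +oo)%E) /\
  (forall A : set (borel_rV R N), measurable A ->
     mu A = ereal_sup [set mu K | K in
                       [set K : set 'rV[R]_N | compact K /\ K `<=` A]]).

Definition log_mgf d (T : measurableType d) (R : realType)
    (P : probability T R) (n : nat) (X : 'I_n -> T -> R) (xi : 'rV[R]_n) : R :=
  ln (\int[P]_w expR (\sum_(i < n) xi 0 i * X i w)).

Definition joint_cumulant d (T : measurableType d) (R : realType)
    (P : probability T R) (n : nat) (X : 'I_n -> T -> R) : R :=
  foldr (fun (i : 'I_n) (f : 'rV[R]_n -> R) => 'D_(delta_mx 0 i) f)
        (log_mgf P X) (enum 'I_n) 0.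

Definition energy (R : realType) (N : nat) (i : 'I_N) (v : borel_rV R N) : R :=
  (v : 'rV[R]_N) 0 i ^+ 2.

Definition nr_cumulant (R : realType) (N : nat)
    (P : probability (borel_rV R N) R) (n : nat) (le_nN : (n <= N)%N) : R :=
  joint_cumulant P (fun i : 'I_n => @energy R N (widen_ord le_nN i)).

(* Main.v *)
Require Import Defs.
From mathcomp Require Import all_boot all_order all_algebra all_fingroup.
From mathcomp Require Import all_classical all_reals all_analysis.
From mathcomp Require Import measurable_realfun ring lra zify.

(* Write e_i = v_i^2. A Kac collision replaces (e_i, e_j) by (e_i + e_j)(cos^2, sin^2)
   with a uniform angle, so the span of the products prod_{i in A} e_i is stable under
   the generator once sum_i e_i = N is used to eliminate the squares e_i^2. Hence the
   moments of distinct energies satisfy a finite linear system; uniqueness for it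
   propagates exchangeability, and m_n = E[e_1 ... e_n] satisfies
     m_n' = n / (4 (N - 1)) (N m_{n-1} - (N + 2n - 2) m_n).
   In terms of M = sum m_n x^n / n! and K = log M = sum kappa_n x^n / n! this reads
     K_t = (N x - N x K' - 2 x^2 (K'' + K'^2)) / (4 (N - 1)),
   so that y_n = kappa_n / (n - 1)! is damped at a rate at least n / 4 and forced by
   - n / (2 (N - 1)) sum_{a + b = n} y_a y_b. By induction on n,
   z_n = N^(alpha (n-1)) y_n is dominated by
     e^(- n t / 4) N^(c (n-1)) (B^n + A t) + D   with A, D = O(N^(alpha - 1)).
   The secular term A t is harmless: it is small up to times of order N^(1 - alpha),
   after which e^(- n t / 4) is smaller than any power of N. *)

Set Implicit Arguments.
Unset Strict Implicit.
Unset Printing Implicit Defensive.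

Import Order.TTheory GRing.Theory Num.Theory.
Import numFieldNormedType.Exports.

Local Open Scope classical_set_scope.
Local Open Scope ring_scope.

(** * Logarithmic derivatives of formal power series *)

(** Turns agreement of finitely many coefficients into an exact polynomial identity with an
    unspecified multiple of ['X^k], so that truncated power series can be handled by [ring]. *)
Lemma poly_eq_modXn (R : comNzRingType) (k : nat) (p q : {poly R}) :
  (forall i, (i < k)%N -> p`_i = q`_i) -> exists w : {poly R}, p = q + w * 'X^k.
Proof.
move=> pq; exists (drop_poly k (p - q)).
have t0 : take_poly k (p - q) = 0.
  apply/polyP => i; rewrite coef_take_poly coef0.
  by case: ifP => // ik; rewrite coefB pq// subrr.
by rewrite -[X in X * _]addr0 -{1}(addrNK q p) -{1}(poly_take_drop k (p - q))
  t0 add0r addr0 addrC.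
Qed.

(** A series with constant term 1 is invertible, hence can be cancelled modulo ['X^k]: the top term
    of each Cauchy product is the coefficient of [p] itself. *)
Lemma coef_mul_eq0 (R : comNzRingType) (k : nat) (p q : {poly R}) :
  q`_0 = 1 -> (forall i, (i < k)%N -> (p * q)`_i = 0) ->
  forall i, (i < k)%N -> p`_i = 0.
Proof.
move=> q0 pq; elim/ltn_ind => i IH ik.
have := pq _ ik; rewrite coefM big_ord_recr/= subnn q0 mulr1 big1 ?add0r//.
by move=> j _; rewrite IH ?mul0r// (ltn_trans _ ik).
Qed.

(* With M = sum b_k x^k and K' = M'/M = sum a_k x^k, the linear equation
   M_t = r (n x M - n x M' - 2 x^2 M'') amounts to
   K_t = r (n x - n x K' - 2 x^2 (K'' + K'^2)). *)
Lemma log_derivative_flow (R : comNzRingType) (d : nat) (r n : R)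
    (a b da db : nat -> R) :
  b 0 = 1 ->
  (forall k, (k < d)%N -> \sum_(i < k.+1) a i * b (k - i)%N = k.+1%:R * b k.+1) ->
  (forall k, (k < d)%N -> \sum_(i < k.+1) (da i * b (k - i)%N + a i * db (k - i)%N)
     = k.+1%:R * db k.+1) ->
  db 0 = 0 ->
  (forall k, (k < d)%N -> db k.+1 =
     r * (n * b k - k.+1%:R * (n + 2 * k%:R) * b k.+1)) ->
  forall k, (k.+1 < d)%N -> da k.+1 =
    - (k.+2%:R * (r * ((n + 2 * k.+1%:R) * a k.+1
         + 2 * \sum_(i < k.+1) a i * a (k - i)%N))).
Proof.
case: d => [//|e] b0 ab dab db0 dbE k kd.
pose A := \poly_(i < e.+1) a i; pose B := \poly_(i < e.+2) b i.
pose A1 := \poly_(i < e.+1) da i; pose B1 := \poly_(i < e.+2) db i.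
have [U UE] : exists w : {poly R}, A * B = B^`() + w * 'X^(e.+1).
  apply: poly_eq_modXn => i ie; rewrite coefM coef_deriv coef_poly ltnS ie.
  rewrite -mulr_natl -ab//; apply: eq_bigr => j _; rewrite !coef_poly.
  have ji : (j <= i)%N by rewrite -ltnS.
  by rewrite (leq_ltn_trans ji ie) (leq_ltn_trans (leq_subr j i) (leqW ie)).
have [V VE] : exists w : {poly R}, A1 * B + A * B1 = B1^`() + w * 'X^(e.+1).
  apply: poly_eq_modXn => i ie; rewrite coefD !coefM coef_deriv coef_poly ltnS ie.
  rewrite -mulr_natl -dab// -big_split/=; apply: eq_bigr => j _; rewrite !coef_poly.
  have ji : (j <= i)%N by rewrite -ltnS.
  by rewrite (leq_ltn_trans ji ie) (leq_ltn_trans (leq_subr j i) (leqW ie)).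
have [W WE] : exists w : {poly R}, B1 = r *: (n *: ('X * B) - n *: ('X * B^`())
    - 2%:R *: ('X * ('X * B^`()^`()))) + w * 'X^(e.+2).
  apply: poly_eq_modXn => -[|i] ie.
    by rewrite coef_poly db0 !(coefZ, coefB, coefXM)/=; ring.
  rewrite coef_poly ie dbE// !(coefZ, coefB, coefXM, coef_deriv)/= coef_poly.
  rewrite ltnW//.
  case: i ie => [|i] ie; rewrite ?(coefZ, coefB, coefXM, coef_deriv)/= ?coef_poly ?ie.
    by ring.
  rewrite -[_ *+ i.+2]mulr_natl; ring.
(* [H] is the claimed K_t, so that M_t = H M. Comparing the x-derivative of M_t with the
   t-derivative of K' M gives ((K')_t - H') M = 0 up to truncation. *)
pose H : {poly R} := r *: (n *: 'X - n *: ('X * A) - 2%:R *: ('X * ('X * (A^`() + A * A)))).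
have key : exists w : {poly R}, (A1 - H^`()) * B = w * 'X^(e.+1).
  have dU : A^`() * B + A * B^`() =
      B^`()^`() + (U^`() * 'X^(e.+1) + U * (e.+1%:R * 'X^e)).
    by rewrite -derivM UE derivD derivM derivXn mulr_natl.
  (* [S] collects the truncation errors. Differentiating ['X^(e.+1)] costs one order, which the two
     factors ['X] in front of the second derivative more than restore. *)
  pose S := W + (r * n) *: U + (2%:R * r) *: (A * U * 'X + U^`() * 'X + U * e.+1%:R).
  have B1E : B1 = H * B + S * 'X^(e.+2).
    have BE : B^`() = A * B - U * 'X^(e.+1) by rewrite UE addrK.
    have B2E : B^`()^`() = A^`() * B + A * (A * B - U * 'X^(e.+1))
         - (U^`() * 'X^(e.+1) + U * (e.+1%:R * 'X^e)).
      by rewrite -BE dU addrK.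
    rewrite WE B2E BE /H /S !exprS -!mul_polyC !rmorphM/= ?polyC_natr.
    ring.
  have dB1 : B1^`() = H^`() * B + H * (A * B - U * 'X^(e.+1))
      + S^`() * 'X^(e.+2) + S * (e.+2%:R * 'X^(e.+1)).
    by rewrite B1E derivD (derivM H) (derivM S) derivXn mulr_natl UE addrK !addrA.
  exists (- H * U + S^`() * 'X + S * e.+2%:R + V - A * S * 'X).
  have -> : (A1 - H^`()) * B = A1 * B + A * B1 - A * B1 - H^`() * B by ring.
  rewrite VE dB1 B1E !exprS; ring.
have /(_ k.+1 kd) : forall i, (i < e.+1)%N -> (A1 - H^`())`_i = 0.
  apply: (@coef_mul_eq0 _ _ _ B); first by rewrite coef_poly.
  move=> i ie; have [w ->] := key.
  by rewrite coefMXn ie.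
move/eqP; rewrite coefB subr_eq0 => /eqP.
have AA : (A * A)`_k = \sum_(i < k.+1) a i * a (k - i)%N.
  rewrite coefM; apply: eq_bigr => i _; rewrite !coef_poly.
  have ik : (i <= k)%N by rewrite -ltnS.
  by rewrite (leq_ltn_trans ik (ltnW kd)) (leq_ltn_trans (leq_subr i k) (ltnW kd)).
rewrite coef_poly kd => ->.
rewrite coef_deriv !(coefZ, coefB, coefXM, coefD, coef_deriv, coefX)/= AA.
rewrite !coef_poly kd -[_ *+ k.+1]mulr_natl -[LHS]mulr_natl; ring.
Qed.

(** * Joint cumulants of bounded exchangeable variables *)

(* The sum of f s1 * g s2 over all splittings of l into two subsequences. *)
Fixpoint leibniz (T : Type) (R : pzRingType) (f g : seq T -> R) (l : seq T) : R :=
  if l is i :: l' then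
    leibniz (fun s => f (i :: s)) g l' + leibniz f (fun s => g (i :: s)) l'
  else f [::] * g [::].

(** Only the splitting that gives all of [l] to the first factor sees the top value [f l]. A Leibniz
    identity therefore determines [f l] from shorter sequences as soon as [g [::]] is invertible. *)
Lemma leibniz_change_top (T : eqType) (R : pzRingType) (f f' g g' : seq T -> R) l :
  (forall s, subseq s l -> (size s < size l)%N -> f s = f' s) ->
  (forall s, subseq s l -> g s = g' s) ->
  leibniz f g l - leibniz f' g' l = (f l - f' l) * g [::].
Proof.
elim: l f f' g g' => [|i l IH] f f' g g' ff' gg' /=.
  by rewrite gg'// mulrBl.
have gg0 : g' [::] = g [::] by rewrite gg'// sub0seq.
have subl s : subseq s l -> subseq s (i :: l).
  by move=> sl; rewrite (subseq_trans sl)// subseq_cons.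
rewrite opprD addrACA IH; last 2 first.
- by move=> s sl ssl; rewrite ff'//= eqxx.
- by move=> s sl; rewrite gg'// subl.
rewrite IH; last 2 first.
- by move=> s sl ssl; rewrite ff' ?subl//= ltnS ltnW.
- by move=> s sl; rewrite gg'//= eqxx.
rewrite [f l]ff' ?subrr ?mul0r ?addr0//.
exact: subl (subseq_refl l).
Qed.

Lemma leibniz_binomial (T : Type) (R : comPzRingType) (phi psi : nat -> R) (l : seq T) :
  leibniz (fun s => phi (size s)) (fun s => psi (size s)) l =
  \sum_(k < (size l).+1) 'C(size l, k)%:R * phi k * psi (size l - k)%N.
Proof.
elim: l phi psi => [|i l IH] phi psi /=.
  by rewrite big_ord_recl big_ord0/= mul1r addr0.
rewrite (IH (phi \o S) psi) (IH phi (psi \o S)) /=.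
set n := size l.
rewrite [RHS]big_ord_recl big_ord_recr/=.
rewrite [X in _ + X]big_ord_recl/= !bin0 !subn0 subnn !binn.
rewrite [in RHS]big_ord_recr/= subSS subnn binn.
rewrite [in RHS](eq_bigr (fun i : 'I_n => 'C(n, i)%:R * phi i.+1 * psi (n - i)%N
    + 'C(n, i.+1)%:R * phi i.+1 * psi (n - i)%N)); last first.
  by move=> j _; rewrite /bump/= add1n binS natrD subSS; ring.
rewrite big_split/= /bump/=.
rewrite [X in _ = _ + (_ + X + _)](eq_bigr (fun i : 'I_n =>
   'C(n, 1 + i)%:R * phi (1 + i)%N * psi (n - (1 + i)).+1)); last first.
  by move=> j _; rewrite add1n -subSn// subSS.
by rewrite add1n addrCA [X in _ + X = _]addrAC.
Qed.

(** With factorial weights the binomial sum becomes a Cauchy product: this is the passage from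
    moments and cumulants to coefficients of generating series. *)
Lemma leibniz_fact (T : Type) (R : comPzRingType) (a b : nat -> R) (l : seq T) :
  leibniz (fun s => a (size s) * (size s)`!%:R) (fun s => b (size s) * (size s)`!%:R) l
  = (size l)`!%:R * \sum_(k < (size l).+1) a k * b (size l - k)%N.
Proof.
rewrite (leibniz_binomial (fun k => a k * k`!%:R) (fun k => b k * k`!%:R)).
rewrite mulr_sumr; apply: eq_bigr => k _.
have kl : (k <= size l)%N by rewrite -ltnS.
have E (x y z p q : R) : x * (p * y) * (q * z) = x * (y * z) * (p * q) by ring.
by rewrite -(bin_fact kl) !natrM E.
Qed.

Lemma eq_is_derive (R : numFieldType) (V W : normedModType R) (f g : V -> W)
    (x v : V) (df dg : W) :
  is_derive x v f df -> f =1 g -> df = dg -> is_derive x v g dg.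
Proof. by move=> fd /funext <- <-. Qed.

Lemma is_derive_line (R : numFieldType) (V W : normedModType R) (f : V -> W)
    (a v : V) (df : W) :
  is_derive (0 : R) 1 (fun h : R => f (h *: v + a)) df -> is_derive a v f df.
Proof.
move=> [dr vl]; split; first exact/derivable1P.
rewrite -vl /derive; set g1 := fun h => h^-1 *: _; set g2 := fun h => h^-1 *: _.
suff -> : g1 = g2 by [].
by apply/funext => h; rewrite /g1 /g2/= addr0 scale0r add0r [_%:A]mulr1.
Qed.

Lemma is_derive_leibniz (T : Type) (R : realFieldType) (V : normedModType R) (x v : V)
    (f g : seq T -> V -> R) (df dg : seq T -> R) (l : seq T) :
  (forall s, is_derive x v (f s) (df s)) -> (forall s, is_derive x v (g s) (dg s)) ->
  is_derive x v (fun y => leibniz (f ^~ y) (g ^~ y) l)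
    (leibniz df (g ^~ x) l + leibniz (f ^~ x) dg l).
Proof.
elim: l f g df dg => [|i l IH] f g df dg fd gd /=.
  apply: (eq_is_derive (is_deriveM (fd [::]) (gd [::]))) => //.
  by rewrite addrC; congr (_ + _); rewrite // mulrC.
have I1 := IH (fun s => f (i :: s)) g (fun s => df (i :: s)) dg (fun s => fd _) gd.
have I2 := IH f (fun s => g (i :: s)) df (fun s => dg (i :: s)) fd (fun s => gd _).
by apply: (eq_is_derive (is_deriveD I1 I2)) => //; rewrite addrACA.
Qed.

(** Each coefficient depends on all earlier ones; storing them in a list makes this strong recursion
    structural. *)
Fixpoint log_coefs (R : pzRingType) (b : nat -> R) (n : nat) : seq R :=
  if n is k.+1 then
    let s := log_coefs b k in
    rcons s (k.+1%:R * b k.+1 - \sum_(i < k) s`_i * b (k - i)%N)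
  else [::].

(* The coefficients of M'/M, where M = sum b_k x^k. *)
Definition log_deriv_coef (R : pzRingType) (b : nat -> R) (n : nat) : R :=
  (log_coefs b n.+1)`_n.

Lemma size_log_coefs (R : pzRingType) (b : nat -> R) n : size (log_coefs b n) = n.
Proof. by elim: n => //= n IH; rewrite size_rcons IH. Qed.

Lemma nth_log_coefs (R : pzRingType) (b : nat -> R) n i :
  (i < n)%N -> (log_coefs b n)`_i = log_deriv_coef b i.
Proof.
elim: n => // n IH; rewrite ltnS leq_eqVlt => /predU1P[->//|ni] /=.
by rewrite nth_rcons size_log_coefs ni IH.
Qed.

Lemma log_deriv_coefE (R : pzRingType) (b : nat -> R) n :
  log_deriv_coef b n =
  n.+1%:R * b n.+1 - \sum_(i < n) log_deriv_coef b i * b (n - i)%N.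
Proof.
rewrite /log_deriv_coef/= nth_rcons size_log_coefs ltnn eqxx; congr (_ - _).
by apply: eq_bigr => i _; rewrite nth_log_coefs.
Qed.

Lemma log_deriv_coef_conv (R : pzRingType) (b : nat -> R) n : b 0 = 1 ->
  \sum_(i < n.+1) log_deriv_coef b i * b (n - i)%N = n.+1%:R * b n.+1.
Proof.
by move=> b0; rewrite big_ord_recr/= subnn b0 mulr1 [X in _ + X]log_deriv_coefE addrCA subrr addr0.
Qed.

(** * Derivatives of the cumulant generating function of bounded variables *)

Section bounded_rv.
Context d (T : measurableType d) (R : realType) (P : probability T R) (D : set T).
Hypotheses (mD : measurable D) (PD : P D = 1%E).

Lemma bounded_integrable (f : T -> R) (M : R) : measurable_fun D f ->
  (forall w, D w -> `|f w| <= M) -> P.-integrable D (EFin \o f).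
Proof.
move=> mf fM; apply: measurable_bounded_integrable => //.
  by apply: (le_lt_trans (probability_le1 P mD)); rewrite ltry.
exists M; split; first exact: num_real.
by move=> y My w Dw; apply: (le_trans (fM _ Dw)); exact: ltW.
Qed.

(** Cumulants are defined by integrals over the whole space, whereas bounds hold only on the event
    [D] of full mass; its complement is a null set. *)
Lemma Rintegral_full (f : T -> R) : measurable_fun setT f ->
  \int[P]_w f w = \int[P]_(w in D) f w.
Proof.
move=> mf; congr fine; rewrite [RHS]integral_mkcond.
apply: ae_eq_integral => //.
- exact/measurable_EFinP.
- apply/(measurable_restrictT _ mD); apply/measurable_EFinP.
  exact: measurable_funTS.
- exists (~` D); split; first exact: measurableC.
    by have := probability_setC P mD; rewrite PD subee.
  move=> w /= nw Dw; apply: nw => _.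
  by rewrite patchE mem_set.
Qed.

(** The integrand is at least exp(-M) on an event of mass one. Positivity keeps the logarithm and
    the inverse of the moment generating function differentiable. *)
Lemma Rintegral_expR_gt0 (f : T -> R) (M : R) : measurable_fun D f ->
  (forall w, D w -> `|f w| <= M) -> 0 < \int[P]_(w in D) expR (f w).
Proof.
move=> mf fM; have M0 : 0 < expR (- M) by exact: expR_gt0.
apply: (lt_le_trans M0).
have -> : expR (- M) = \int[P]_(w in D) (cst (expR (- M)) w).
  by rewrite Rintegral_cst//= PD mulr1.
apply: le_Rintegral => //.
- by apply: (@bounded_integrable _ (expR (- M))) => // w _; rewrite ger0_norm// ltW.
- apply: (@bounded_integrable _ (expR M)); first exact: measurableT_comp.
  move=> w Dw; rewrite ger0_norm ?expR_ge0// ler_expR.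
  by rewrite (le_trans (ler_norm _))// fM.
- move=> w Dw; rewrite ler_expR.
  by have := fM _ Dw; rewrite ler_norml => /andP[].
Qed.

Context (n : nat) (X : 'I_n -> T -> R) (M : R).
Hypothesis mX : forall i, measurable_fun setT (X i).
Hypothesis XM : forall i w, D w -> `|X i w| <= M.

(** Unnormalised moments under an exponential tilt: [tilted_moment [::]] is the moment generating
    function, and each partial derivative prepends one index to [s]. *)
Definition tilted_moment (s : seq 'I_n) (xi : 'rV[R]_n) : R :=
  \int[P]_(w in D) (\prod_(i <- s) X i w * expR (\sum_(i < n) xi 0 i * X i w)).

Let V : normedModType R := 'rV[R]_n.

Let mprod s : measurable_fun setT (fun w => \prod_(i <- s) X i w).
Proof.
elim: s => [|i s IH].
  by rewrite (_ : (fun w => _) = cst 1)//; apply/funext => w; rewrite big_nil.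
rewrite (_ : (fun w => _) = X i \* (fun w => \prod_(i <- s) X i w)).
  by apply: measurable_funM.
by apply/funext => w; rewrite big_cons.
Qed.

Let msum (xi : 'rV[R]_n) : measurable_fun setT (fun w => \sum_(i < n) xi 0 i * X i w).
Proof.
by apply: measurable_sum => i; apply: measurable_funM.
Qed.

Let mexp (xi : 'rV[R]_n) :
  measurable_fun setT (fun w => expR (\sum_(i < n) xi 0 i * X i w)).
Proof. exact: measurableT_comp. Qed.

Let sum_le (xi : 'rV[R]_n) w : D w ->
  `|\sum_(i < n) xi 0 i * X i w| <= \sum_(i < n) `|xi 0 i| * M.
Proof.
move=> Dw; apply: (le_trans (ler_norm_sum _ _ _)); apply: ler_sum => i _.
by rewrite normrM ler_wpM2l// XM.
Qed.

Let prod_le s w : D w -> `|\prod_(i <- s) X i w| <= \prod_(i <- s) M.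
Proof.
move=> Dw; rewrite normr_prod; apply: ler_prod => i _.
by rewrite normr_ge0 XM.
Qed.

Let integrand_le s (xi : 'rV[R]_n) w : D w ->
  `|\prod_(i <- s) X i w * expR (\sum_(i < n) xi 0 i * X i w)| <=
  (\prod_(i <- s) M) * expR (\sum_(i < n) `|xi 0 i| * M).
Proof.
move=> Dw; rewrite normrM; apply: ler_pM => //; first exact: prod_le.
rewrite ger0_norm ?expR_ge0// ler_expR (le_trans (ler_norm _))//.
exact: sum_le.
Qed.

Lemma tilted_moment_gt0 xi : 0 < tilted_moment [::] xi.
Proof.
rewrite /tilted_moment.
under eq_Rintegral do rewrite big_nil mul1r.
by apply: Rintegral_expR_gt0; [exact: measurable_funTS|exact: sum_le].
Qed.

Lemma is_derive_tilted_moment s i (xi : V) :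
  is_derive xi (delta_mx 0 i : V) (tilted_moment s : V -> R) (tilted_moment (i :: s) xi).
Proof.
apply: is_derive_line.
pose f (h : R) w := \prod_(j <- s) X j w *
  expR (\sum_(j < n) (h *: delta_mx 0 i + xi) 0 j * X j w).
have sumE h w : \sum_(j < n) (h *: delta_mx 0 i + xi) 0 j * X j w =
    h * X i w + \sum_(j < n) xi 0 j * X j w.
  under eq_bigr do rewrite !mxE mulrDl.
  rewrite big_split/=; congr (_ + _).
  rewrite (bigD1 i)//= !eqxx mulr1 big1 ?addr0// => j /negPf ji.
  by rewrite ji mulr0 mul0r.
pose f1 (h : R) w := \prod_(j <- i :: s) X j w *
  expR (\sum_(j < n) (h *: delta_mx 0 i + xi) 0 j * X j w).
have fD (h : R) w : is_derive h (1 : R) (f ^~ w) (f1 h w).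
  have E : is_derive h (1 : R) (fun h : R => h * X i w + \sum_(j < n) xi 0 j * X j w) (X i w).
    by apply: is_derive_eq; rewrite addr0 scaler0 add0r [_%:A]mulr1.
  have E' := is_deriveZ (\prod_(j <- s) X j w) (is_derive1_comp (is_derive_expR _) E).
  apply: (eq_is_derive E') => [h'|]; first by rewrite /f sumE.
  rewrite /f1 sumE big_cons /GRing.scale/=; ring.
have M0 w : D w -> 0 <= M by move=> Dw; apply: le_trans (XM i Dw).
(* For [h] in ]-1, 1[ each coordinate of the tilt grows by at most 1 in absolute value, so a
   constant dominates the differentiated integrand. *)
pose G := \prod_(j <- i :: s) M * expR (\sum_(j < n) (1 + `|xi 0 j|) * M).
have fle h w : h \in `]-1, 1[ -> D w -> `|f1 h w| <= G.
  rewrite in_itv/= => /andP[h1 h2] Dw; apply: (le_trans (integrand_le _ _ Dw)).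
  apply: ler_wpM2l; first by apply: prodr_ge0 => j _; exact: M0 Dw.
  rewrite ler_expR; apply: ler_sum => j _; rewrite ler_wpM2r//; first exact: M0 Dw.
  rewrite !mxE (le_trans (ler_normD _ _))// lerD2r normrM.
  have hle : `|h| <= 1 by rewrite ler_norml; apply/andP; split; exact: ltW.
  case: (_ && _); rewrite ?normr0 ?mulr0// normr1 mulr1//.
have d1 h w : partial1of2 f h w = f1 h w.
  by rewrite partial1of2E (derive_val (is_derive := fD h w)).
have I0 : `]-1, 1[%classic (0 : R) by rewrite /= in_itv/= ltrN10 ltr01.
have := @cvg_differentiation_under_integral R d T P f D mD 0 (-1) 1 I0.
have -> : \int[P]_(w in D) partial1of2 f 0 w = tilted_moment (i :: s) xi.
  rewrite /tilted_moment; apply: eq_Rintegral => w _; rewrite d1 /f1.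
  by rewrite scale0r add0r.
have intf s' x : P.-integrable D (EFin \o (fun w => \prod_(j <- s') X j w *
  expR (\sum_(j < n) (x *: delta_mx 0 i + xi) 0 j * X j w))).
  apply: bounded_integrable; last by move=> w Dw; exact: (integrand_le _ _ Dw).
  by apply: measurable_funTS; apply: measurable_funM.
move=> /(_ (fun x _ => intf s x) (fun h w _ _ => ex_derive (is_derive := fD h w))).
have G0 : 0 <= `|G| by [].
move=> /(_ (cst `|G|) (fun=> G0)).
have iG : P.-integrable D (EFin \o cst `|G|).
  by apply: (@bounded_integrable _ `|G|) => // w _; rewrite /= normr_id.
move=> /(_ iG).
have db x w : x \in `]-1, 1[%classic -> D w -> `|partial1of2 f x w| <= cst `|G| w.
  move=> xI Dw; rewrite d1 (le_trans (fle _ _ _ Dw)) ?ler_norm//.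
  by move: xI; rewrite inE.
move=> /(_ (fun x w xI => db x w (mem_set xI))) H.
have H' : h^-1 *: (((fun h => tilted_moment s (h *: delta_mx 0 i + xi)) \o shift 0) (h *: 1)
    - (fun h : R => tilted_moment s (h *: delta_mx 0 i + xi)) 0)
    @[h --> (0 : R)^'] --> tilted_moment (i :: s) xi.
  move: H; apply: cvg_trans; apply: near_eq_cvg; near=> h.
  by rewrite /= [h%:A]mulr1.
split; first by apply/cvg_ex; eexists; exact: H'.
exact: cvg_lim H'.
Unshelve. all: by end_near. Qed.

(* Stable under partial derivatives and containing those of xi |-> log E[exp <xi, X>]:
   this is how the smoothness of the cumulant generating function is obtained. *)
Inductive tilted_algebra : (V -> R) -> Prop :=
| tilted_algebra_moment s : tilted_algebra (tilted_moment s)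
| tilted_algebra_inv : tilted_algebra (fun xi => (tilted_moment [::] xi)^-1)
| tilted_algebra_cst a : tilted_algebra (cst a)
| tilted_algebra_add f g : tilted_algebra f -> tilted_algebra g -> tilted_algebra (f + g)
| tilted_algebra_mul f g : tilted_algebra f -> tilted_algebra g -> tilted_algebra (f * g).

Lemma tilted_algebra_derive f (i : 'I_n) : tilted_algebra f ->
  tilted_algebra ('D_(delta_mx 0 i : V) f) /\
  forall xi, derivable f xi (delta_mx 0 i : V).
Proof.
elim=> {f} [s||a|f g Af [Af' df] Ag [Ag' dg]|f g Af [Af' df] Ag [Ag' dg]].
- split; last by move=> xi; exact: (ex_derive (is_derive := is_derive_tilted_moment s i xi)).
  rewrite (_ : derive _ ^~ _ = tilted_moment (i :: s)); first by constructor.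
  by apply/funext => xi; rewrite (derive_val (is_derive := is_derive_tilted_moment s i xi)).
- have Z0 xi : tilted_moment [::] xi != 0 by rewrite gt_eqF// tilted_moment_gt0.
  have dZ xi := ex_derive (is_derive := is_derive_tilted_moment [::] i xi).
  split; last by move=> xi; exact: derivableV.
  rewrite (_ : derive _ ^~ _ = cst (-1) * (fun xi => (tilted_moment [::] xi)^-1)
    * (fun xi => (tilted_moment [::] xi)^-1) * tilted_moment [:: i]).
    by do 4 constructor.
  apply/funext => xi; rewrite (deriveV (Z0 xi) (dZ xi)).
  rewrite (derive_val (is_derive := is_derive_tilted_moment [::] i xi)).
  by rewrite /GRing.scale/= !fctE/= mulN1r expr2 invfM !mulNr.
- split; last by move=> xi; exact: derivable_cst.
  rewrite (_ : derive _ ^~ _ = cst 0); first by constructor.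
  by apply/funext => xi; rewrite derive_cst.
- split; last by move=> xi; exact: derivableD.
  rewrite (_ : derive _ ^~ _ = 'D_(delta_mx 0 i : V) f + 'D_(delta_mx 0 i : V) g).
    by constructor.
  by apply/funext => xi; rewrite deriveD.
- split; last by move=> xi; exact: derivableM.
  rewrite (_ : derive _ ^~ _ = f * 'D_(delta_mx 0 i : V) g + g * 'D_(delta_mx 0 i : V) f).
    by do 2 constructor.
  by apply/funext => xi; rewrite deriveM.
Qed.

Definition partials (f : V -> R) (s : seq 'I_n) : V -> R :=
  foldr (fun (i : 'I_n) (g : 'rV[R]_n -> R) => 'D_(delta_mx 0 i) g) f s.

Lemma tilted_algebra_partials f s : tilted_algebra f -> tilted_algebra (partials f s).
Proof. by move=> Af; elim: s => //= i s /(tilted_algebra_derive i)[]. Qed.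

Lemma partialsM f g s : tilted_algebra f -> tilted_algebra g ->
  partials (f * g) s = (fun xi => leibniz (partials f ^~ xi) (partials g ^~ xi) s).
Proof.
move=> Af Ag; elim: s => [//|i s IH]; apply/funext => xi.
have dd h l : tilted_algebra h ->
    is_derive xi (delta_mx 0 i : V) (partials h l) (partials h (i :: l) xi).
  move=> Ah; apply: derivableP.
  by have [_] := tilted_algebra_derive i (tilted_algebra_partials l Ah); apply.
rewrite /= -/(partials (f * g) s) IH.
exact: (derive_val
  (is_derive := is_derive_leibniz s (fun l => dd f l Af) (fun l => dd g l Ag))).
Qed.

Lemma log_mgfE : log_mgf P X = (fun xi => ln (tilted_moment [::] xi)).
Proof.
apply/funext => xi; rewrite /log_mgf /tilted_moment Rintegral_full//.
by congr ln; apply: eq_Rintegral => w _; rewrite big_nil mul1r.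
Qed.

Lemma derive_log_mgf (a : 'I_n) : 'D_(delta_mx 0 a : V) (log_mgf P X) =
  tilted_moment [:: a] * (fun xi => (tilted_moment [::] xi)^-1).
Proof.
rewrite log_mgfE; apply/funext => xi.
have dZ := is_derive_tilted_moment [::] a xi.
pose g (h : R) := tilted_moment [::] (h *: (delta_mx 0 a : V) + xi).
have dg : is_derive (0 : R) 1 g (tilted_moment [:: a] xi).
  have dg := (derivable1P (tilted_moment [::] : V -> R) xi (delta_mx 0 a)).1
    (ex_derive (is_derive := dZ)).
  split; first exact: dg.
  rewrite -(derive_val (is_derive := dZ)) /derive.
  set g1 := fun h => h^-1 *: _; set g2 := fun h => h^-1 *: _.
  suff -> : g1 = g2 by [].
  by apply/funext => h; rewrite /g1 /g2/= /g addr0 scale0r add0r [_%:A]mulr1.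
have dln : is_derive (g 0) 1 (@ln R) (tilted_moment [::] xi)^-1.
  rewrite /g scale0r add0r; apply: is_derive1_ln; exact: tilted_moment_gt0.
have dl := @is_derive_line _ _ _ (fun y : V => ln (tilted_moment [::] y)) _ _ _
  (is_derive1_comp dln dg).
by rewrite (derive_val (is_derive := dl)) mulrC.
Qed.

Lemma partials_tilted_moment t s : partials (tilted_moment t) s = tilted_moment (s ++ t).
Proof.
elim: s => [//|i s IH]; apply/funext => xi; rewrite /= -/(partials _ _) IH.
by rewrite (derive_val (is_derive := is_derive_tilted_moment (s ++ t) i xi)).
Qed.

(** Write Z for the moment generating function. The iterated product rule is applied to d_a Z = (d_a
    log Z) Z; taking one derivative first removes the logarithm and leaves a quotient in
    [tilted_algebra]. *)
Lemma tilted_moment_leibniz (a : 'I_n) (s : seq 'I_n) xi :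
  tilted_moment (s ++ [:: a]) xi =
  leibniz (fun l => partials (log_mgf P X) (l ++ [:: a]) xi)
          (fun l => tilted_moment l xi) s.
Proof.
have -> : (fun l => partials (log_mgf P X) (l ++ [:: a]) xi) =
    (fun l => partials ('D_(delta_mx 0 a : V) (log_mgf P X)) l xi).
  by apply/funext => l; rewrite /partials foldr_cat.
have -> : tilted_moment ^~ xi = partials (tilted_moment [::]) ^~ xi.
  by apply/funext => l; rewrite partials_tilted_moment cats0.
have Aa : tilted_algebra (tilted_moment [:: a] * (fun xi => (tilted_moment [::] xi)^-1)).
  by do 2 constructor.
rewrite derive_log_mgf -partials_tilted_moment.
have := partialsM s Aa (tilted_algebra_moment [::]).
move=> /(congr1 (@^~ xi)) <-; congr (partials _ _ _).
apply/funext => x; rewrite !fctE mulfVK//.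
by rewrite gt_eqF// tilted_moment_gt0.
Qed.

Section exchangeable.
Variable b : nat -> R.
Hypothesis b0 : b 0 = 1.
Hypothesis momentE : forall s, uniq s -> tilted_moment s 0 = b (size s) * (size s)`!%:R.

(** Strong induction on the length. Cumulants and the weighted [log_deriv_coef] satisfy the same
    convolution identity with the moments, and [leibniz_change_top] isolates the top term with
    factor [tilted_moment [::] 0], which is 1. Subsequences of distinct indices stay distinct, so
    only non-repeated moments occur. *)
Lemma partials_log_mgf (a : 'I_n) s : uniq (s ++ [:: a]) ->
  partials (log_mgf P X) (s ++ [:: a]) 0 = log_deriv_coef b (size s) * (size s)`!%:R.
Proof.
have [m] := ubnP (size s); elim: m s => // m IH s sm us.
have us' : uniq s by move: us; rewrite cat_uniq => /andP[].
have H := tilted_moment_leibniz a s 0.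
have := @leibniz_change_top _ _ (fun l => partials (log_mgf P X) (l ++ [:: a]) 0)
  (fun l => log_deriv_coef b (size l) * (size l)`!%:R)
  (fun l => tilted_moment l 0) (fun l => b (size l) * (size l)`!%:R) s.
rewrite -H leibniz_fact log_deriv_coef_conv// momentE// size_cat/= addn1.
rewrite momentE//= b0 mul1r mulr1 factS natrM => E.
apply/eqP; rewrite -subr_eq0; apply/eqP; rewrite -E; first last.
- by move=> l ls; rewrite momentE// (subseq_uniq ls).
- move=> l ls lsz; apply: IH; first exact: (leq_trans lsz).
  by apply: (subseq_uniq _ us); apply: cat_subseq.
by rewrite mulrCA mulrA [X in X - _]mulrC subrr.
Qed.

Lemma joint_cumulantE : (0 < n)%N ->
  joint_cumulant P X = log_deriv_coef b n.-1 * (n.-1)`!%:R.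
Proof.
move=> n0; rewrite /joint_cumulant.
have := enum_uniq 'I_n; have : size (enum 'I_n) = n by rewrite size_enum_ord.
(* [foldr] differentiates in the last index first; that index is the distinguished [a], which leaves
   n - 1 others and explains the shift to [n.-1]. *)
case/lastP: (enum 'I_n) => [/= n0'|s a]; first by exfalso; move: n0; rewrite -n0'.
rewrite size_rcons -cats1 => sn us.
rewrite -/(partials _ _) partials_log_mgf//.
have -> : size s = n.-1 by rewrite -[in RHS]sn.
by [].
Qed.

End exchangeable.

End bounded_rv.

(** * The generator on products of energies *)

Lemma Rintegral_FTC2 (R : realType) (F f : R -> R) (a b : R) : a < b ->
  (forall x : R, is_derive x (1 : R) F (f x)) -> continuous f ->
  \int[lebesgue_measure]_(x in `[a, b]) f x = F b - F a.
Proof.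
move=> ab Ff cf.
have cF : continuous F.
  move=> x; apply: differentiable_continuous; apply/derivable1_diffP.
  exact: (ex_derive (is_derive := Ff x)).
rewrite /Rintegral (@continuous_FTC2 _ f F)//.
- exact: continuous_subspaceT.
- split.
  + by move=> x _; exact: (ex_derive (is_derive := Ff x)).
  + by apply: cvg_at_right_filter; exact: cF.
  + by apply: cvg_at_left_filter; exact: cF.
- by move=> x _; rewrite derive1E (derive_val (is_derive := Ff x)).
Qed.

(** * Averages over the collision angle *)

Section circle.
Context (R : realType).
Variables a b : R.
Let u t : R := cos t * a + sin t * b.
Let w t : R := - sin t * a + cos t * b.
Let rho := a ^+ 2 + b ^+ 2.

Let du (t : R) : is_derive t (1 : R) u (w t).
Proof.
apply: (eq_is_derive (is_deriveD (is_deriveM (is_derive_cos t) (is_derive_cst a t (1:R)))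
  (is_deriveM (is_derive_sin t) (is_derive_cst b t (1:R))))) => //.
rewrite /w /GRing.scale/=; ring.
Qed.

Let dw (t : R) : is_derive t (1 : R) w (- u t).
Proof.
apply: (eq_is_derive (is_deriveD
  (is_deriveM (is_deriveN (is_derive_sin t)) (is_derive_cst a t (1:R)))
  (is_deriveM (is_derive_cos t) (is_derive_cst b t (1:R))))) => //.
rewrite /u /GRing.scale/=; ring.
Qed.

Let rhoE t : u t ^+ 2 + w t ^+ 2 = rho.
Proof.
have := cos2Dsin2 t; rewrite /u /w /rho => E.
rewrite -[a ^+ 2]mul1r -[b ^+ 2]mul1r -E; ring.
Qed.

Let cu : continuous u.
Proof.
move=> x; apply: differentiable_continuous; apply/derivable1_diffP.
exact: (ex_derive (is_derive := du x)).
Qed.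

Let cw : continuous w.
Proof.
move=> x; apply: differentiable_continuous; apply/derivable1_diffP.
exact: (ex_derive (is_derive := dw x)).
Qed.

Let uw t : is_derive t (1 : R) (fun t => u t * w t) (w t ^+ 2 - u t ^+ 2).
Proof.
apply: (eq_is_derive (is_deriveM (du t) (dw t))) => //.
rewrite /GRing.scale/=; ring.
Qed.

Let npipi : - pi < pi :> R.
Proof. by rewrite -subr_gt0 opprK addr_gt0// pi_gt0. Qed.

Let upi : u pi = u (- pi).
Proof. by rewrite /u cosN sinN sinpi !oppr0. Qed.

Let wpi : w pi = w (- pi).
Proof. by rewrite /w cosN sinN sinpi !oppr0. Qed.

Let did (t : R) : is_derive t (1 : R) (id : R -> R) 1.
Proof. exact: is_derive_id. Qed.

Let pi0 : pi != 0 :> R.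
Proof. by rewrite gt_eqF// pi_gt0. Qed.

Lemma circle_average1 k :
  \int[lebesgue_measure]_(t in `[- pi, pi])
    (k * (cos t * a + sin t * b) ^+ 2 / (2 * pi)) = k * (a ^+ 2 + b ^+ 2) / 2.
Proof.
(* As u' = w, w' = - u and u^2 + w^2 = rho, the function rho t - u w is a primitive of 2 u^2; the
   periodic part u w cancels between the endpoints. *)
refine (etrans (@Rintegral_FTC2 _ (fun t => (rho * t - u t * w t) * (k / 2 / (2 * pi)))
  _ _ _ npipi _ _) _).
- move=> t.
  apply: (eq_is_derive (is_deriveM (is_deriveB (is_deriveZ rho (did t)) (uw t))
    (is_derive_cst (k / 2 / (2 * pi)) t (1 : R)))) => //.
  rewrite /GRing.scale/= -(rhoE t) -/(u t); have := pi0; move: (pi : R) => p p0; field; exact: p0.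
- move=> t; apply: cvgM; last exact: cvg_cst.
  by apply: cvgM; [exact: cvg_cst|apply: cvgM; exact: cu].
- rewrite upi wpi -/rho; have := pi0; move: (pi : R) => p p0; field; exact: p0.
Qed.

Lemma circle_average2 k :
  \int[lebesgue_measure]_(t in `[- pi, pi])
    (k * (- sin t * a + cos t * b) ^+ 2 / (2 * pi)) = k * (a ^+ 2 + b ^+ 2) / 2.
Proof.
refine (etrans (@Rintegral_FTC2 _ (fun t => (rho * t + u t * w t) * (k / 2 / (2 * pi)))
  _ _ _ npipi _ _) _).
- move=> t.
  apply: (eq_is_derive (is_deriveM (is_deriveD (is_deriveZ rho (did t)) (uw t))
    (is_derive_cst (k / 2 / (2 * pi)) t (1 : R)))) => //.
  rewrite /GRing.scale/= -(rhoE t) -/(w t); have := pi0; move: (pi : R) => p p0; field; exact: p0.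
- move=> t; apply: cvgM; last exact: cvg_cst.
  by apply: cvgM; [exact: cvg_cst|apply: cvgM; exact: cw].
- rewrite upi wpi -/rho; have := pi0; move: (pi : R) => p p0; field; exact: p0.
Qed.

(** Its derivative is (w^2 - u^2)^2 - 4 u^2 w^2 = rho^2 - 8 u^2 w^2, so it serves as the periodic
    part of a primitive of 8 u^2 w^2. *)
Let W t := u t * w t * (w t ^+ 2 - u t ^+ 2).

Let dW t : is_derive t (1 : R) W (rho ^+ 2 - 8 * (u t ^+ 2 * w t ^+ 2)).
Proof.
have d1 := is_deriveB (is_deriveM (dw t) (dw t)) (is_deriveM (du t) (du t)).
apply: (eq_is_derive (is_deriveM (uw t) d1)) => [x|].
  by rewrite /W.
rewrite /GRing.scale/= !fctE -(rhoE t); ring.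
Qed.

Lemma circle_average12 k :
  \int[lebesgue_measure]_(t in `[- pi, pi])
    (k * ((cos t * a + sin t * b) ^+ 2 * (- sin t * a + cos t * b) ^+ 2) / (2 * pi))
  = k * (a ^+ 2 + b ^+ 2) ^+ 2 / 8.
Proof.
refine (etrans (@Rintegral_FTC2 _ (fun t => (rho ^+ 2 * t - W t) * (k / 8 / (2 * pi)))
  _ _ _ npipi _ _) _).
- move=> t.
  apply: (eq_is_derive (is_deriveM (is_deriveB (is_deriveZ (rho ^+ 2) (did t)) (dW t))
    (is_derive_cst (k / 8 / (2 * pi)) t (1 : R)))) => //.
  rewrite /GRing.scale/= -/(u t) -/(w t); have := pi0; move: (pi : R) => p p0; field; exact: p0.
- move=> t; apply: cvgM; last exact: cvg_cst.
  apply: cvgM; first exact: cvg_cst.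
  by apply: cvgM; apply: cvgM; [exact: cu|exact: cu|exact: cw|exact: cw].
- rewrite /W upi wpi -/rho; have := pi0; move: (pi : R) => p p0; field; exact: p0.
Qed.

Lemma circle_average0 (k : R) :
  \int[lebesgue_measure]_(t in `[- pi, pi]) (k / (2 * pi)) = k.
Proof.
refine (etrans (@Rintegral_FTC2 _ (fun t => t * (k / (2 * pi))) _ _ _ npipi _ _) _).
- move=> t.
  apply: (eq_is_derive (is_deriveM (did t) (is_derive_cst (k / (2 * pi)) t (1 : R)))) => //.
  by rewrite /GRing.scale/= mulr0 add0r mulr1.
- by move=> t; exact: cvg_cst.
- have := pi0; move: (pi : R) => p p0; field; exact: p0.
Qed.

End circle.

Section generator.
Context (R : realType) (N : nat).
Implicit Types (A : {set 'I_N}) (v : 'rV[R]_N).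

Definition energy_prod A v : R := \prod_(k in A) v 0 k ^+ 2.

Lemma energy_prodD1 A i v : i \in A ->
  energy_prod A v = v 0 i ^+ 2 * energy_prod (A :\ i) v.
Proof. by move=> iA; rewrite /energy_prod (big_setD1 i). Qed.

Lemma energy_prodU1 A i v : i \notin A ->
  energy_prod (i |: A) v = v 0 i ^+ 2 * energy_prod A v.
Proof. by move=> iA; rewrite /energy_prod big_setU1. Qed.

Lemma energy_prodD2 A i j v : i != j ->
  energy_prod A v = (if i \in A then v 0 i ^+ 2 else 1)
    * (if j \in A then v 0 j ^+ 2 else 1) * energy_prod (A :\ i :\ j) v.
Proof.
move=> ij; have <- : (j \in A :\ i) = (j \in A) by rewrite !inE eq_sym ij.
have step B k : energy_prod B v = (if k \in B then v 0 k ^+ 2 else 1) * energy_prod (B :\ k) v.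
  case: ifP => kB; first exact: energy_prodD1.
  rewrite mul1r; congr energy_prod; apply/setP => l; rewrite !inE.
  by case: eqVneq => // ->.
by rewrite (step A i) (step (A :\ i) j) mulrA.
Qed.

Lemma energy_prod_rotation A i j theta v : i != j ->
  energy_prod A (kac_rotation i j theta v) =
    (if i \in A then (cos theta * v 0 i + sin theta * v 0 j) ^+ 2 else 1)
    * (if j \in A then (- sin theta * v 0 i + cos theta * v 0 j) ^+ 2 else 1)
    * energy_prod (A :\ i :\ j) v.
Proof.
move=> ij; rewrite (energy_prodD2 _ _ ij) !mxE eqxx [j == i]eq_sym (negPf ij) eqxx.
congr (_ * _); apply: eq_bigr => k; rewrite !inE => /and3P[kj ki _].
by rewrite mxE (negPf ki) (negPf kj).
Qed.

(** The share of index [i] in the mean change caused by a collision of [i] and [j]. If both lie in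
    [A], the factor e_i e_j changes by (e_i + e_j)^2 / 8 - e_i e_j = e_i^2 / 8 + e_j^2 / 8 - 3 e_i
    e_j / 4; each index takes one square and half of the cross term. *)
Definition jump A i j v : R :=
  if i \in A then
    energy_prod (A :\ i) v * v 0 j ^+ 2 * (if j \in A then 8^-1 else 2^-1)
    - energy_prod A v * (if j \in A then 3 / 8 else 2^-1)
  else 0.

Lemma rotation_average A i j v : i != j ->
  \int[lebesgue_measure]_(theta in `[- pi, pi])
    (energy_prod A (kac_rotation i j theta v) / (2 * pi)) =
  energy_prod A v + (jump A i j v + jump A j i v).
Proof.
move=> ij; have ji : j != i by rewrite eq_sym.
under eq_Rintegral do rewrite energy_prod_rotation//.
rewrite /jump; set E := energy_prod (A :\ i :\ j) v.
have EA : energy_prod A v = (if i \in A then v 0 i ^+ 2 else 1)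
    * (if j \in A then v 0 j ^+ 2 else 1) * E by exact: energy_prodD2.
have EAi : energy_prod (A :\ i) v = (if j \in A then v 0 j ^+ 2 else 1) * E.
  rewrite (energy_prodD2 _ _ ij) !inE eqxx ji/= mul1r /E.
  congr (_ * energy_prod _ v).
  by apply/setP => k; rewrite !inE; case: (k == j); case: (k == i).
have EAj : energy_prod (A :\ j) v = (if i \in A then v 0 i ^+ 2 else 1) * E.
  rewrite (energy_prodD2 _ _ ij) !inE eqxx ij/= mulr1 /E; congr (_ * energy_prod _ v).
  by apply/setP => k; rewrite !inE; case: (k == j); case: (k == i).
rewrite EA EAi EAj.
case: (i \in A); case: (j \in A).
- under eq_Rintegral do rewrite -[X in X / _]mulrC.
  rewrite circle_average12; by field.
- under eq_Rintegral do rewrite mulr1 -[X in X / _]mulrC.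
  rewrite circle_average1; by field.
- under eq_Rintegral do rewrite mul1r -[X in X / _]mulrC.
  rewrite circle_average2; by field.
- under eq_Rintegral do rewrite !mul1r.
  by rewrite circle_average0 !mul1r !addr0.
Qed.

(** The closed linear system obeyed by products of distinct energies. It is written for an arbitrary
    function of sets so that it applies both pointwise and to expectations. *)
Definition energy_rhs (x : {set 'I_N} -> R) A : R :=
  (N%:R - 1)^-1 * \sum_(i in A) (N%:R / 4 * x (A :\ i)
    + 3 / 4 * (\sum_(j | j \notin A) x (j |: A :\ i))
    - (4^-1 + 3 / 4 * (#|A|%:R - 1) + (N%:R - #|A|%:R)) * x A).

Lemma sum_jump A i v : kac_sphere N v -> i \in A ->
  2 * (\sum_(j < N | i != j) jump A i j v) =
  N%:R / 4 * energy_prod (A :\ i) v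
    + 3 / 4 * (\sum_(j | j \notin A) energy_prod (j |: A :\ i) v)
    - (4^-1 + 3 / 4 * (#|A|%:R - 1) + (N%:R - #|A|%:R)) * energy_prod A v.
Proof.
move=> vS iA; rewrite (bigID (mem A))/=.
have -> : \sum_(j < N | (i != j) && (j \in A)) jump A i j v =
    energy_prod (A :\ i) v / 8 * (\sum_(j in A :\ i) v 0 j ^+ 2)
    - (#|A|%:R - 1) * (3 / 8 * energy_prod A v).
  rewrite mulr_sumr; have -> : #|A|%:R - 1 = #|A :\ i|%:R :> R.
    by rewrite (cardsD1 i A) iA natrD addrC addKr.
  rewrite [#|_|%:R * _]mulr_natl -sumr_const -sumrB.
  apply: eq_big => [j|j /andP[ij jA]]; first by rewrite !inE eq_sym.
  rewrite /jump iA jA; ring.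
have -> : \sum_(j < N | (i != j) && (j \notin A)) jump A i j v =
    2^-1 * (\sum_(j | j \notin A) energy_prod (j |: A :\ i) v)
    - (N%:R - #|A|%:R) * (2^-1 * energy_prod A v).
  have -> : N%:R - #|A|%:R = #|~: A|%:R :> R.
    by rewrite -[X in X%:R - _]card_ord -(cardsC A) natrD addrC addKr.
  rewrite [#|_|%:R * _]mulr_natl -sumr_const mulr_sumr.
  rewrite [X in _ - X](eq_bigl (fun j => j \notin A)); last by move=> j; rewrite inE.
  rewrite -sumrB; apply: eq_big => [j|j /andP[ij jA]].
    by case: eqVneq => // <-; rewrite iA.
  rewrite /jump iA (negPf jA) energy_prodU1 ?inE ?(negPf jA) ?andbF//; ring.
(* The sphere constraint closes the system: the energies in [A :\ i], which would create squares
   e_j^2, are traded for N, e_i and the energies outside [A]. *)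
have SE : \sum_(j in A :\ i) v 0 j ^+ 2 = N%:R - v 0 i ^+ 2 - \sum_(j | j \notin A) v 0 j ^+ 2.
  have := vS; rewrite /kac_sphere/= => <-.
  rewrite [in RHS](bigID (mem A))/= [X in _ = X + _ - _ - _](big_setD1 i)//=; ring.
have -> : \sum_(j | j \notin A) energy_prod (j |: A :\ i) v =
    energy_prod (A :\ i) v * \sum_(j | j \notin A) v 0 j ^+ 2.
  rewrite mulr_sumr; apply: eq_bigr => j jA.
  by rewrite energy_prodU1 ?inE ?(negPf jA) ?andbF// mulrC.
rewrite SE (energy_prodD1 _ iA); by field.
Qed.

Lemma kac_generator_energy_prod A v : (1 < N)%N -> kac_sphere N v ->
  kac_generator (energy_prod A) v = energy_rhs (energy_prod ^~ v) A.
Proof.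
move=> N1 vS.
have N0 : N%:R != 0 :> R by rewrite pnatr_eq0; lia.
have N10 : N%:R - 1 != 0 :> R by rewrite subr_eq0 (eqr_nat R N 1); lia.
have S1 : \sum_(i < N) \sum_(j < N | i != j) (1 : R) = N%:R * (N%:R - 1).
  under eq_bigr => i _.
    rewrite sumr_const (_ : #|_| = N.-1); last first.
      have := cardC1 i; rewrite card_ord => <-; apply: eq_card => j.
      by rewrite !inE eq_sym.
    over.
  rewrite /= sumr_const card_ord -subn1 mulr_natl natrB//; lia.
rewrite /kac_generator /kac_Q.
under eq_bigr => i _ do under eq_bigr => j ij do rewrite rotation_average//.
(* Over ordered pairs the two jumps contribute equally by exchanging [i] and [j], whence the factor
   2. *)
have -> : \sum_(i < N) \sum_(j < N | i != j)
    (energy_prod A v + (jump A i j v + jump A j i v)) =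
  N%:R * (N%:R - 1) * energy_prod A v
    + \sum_(i in A) (2 * \sum_(j < N | i != j) jump A i j v).
  under eq_bigr do rewrite !big_split/=.
  rewrite !big_split/= -S1; congr (_ + _).
    rewrite mulr_suml; apply: eq_bigr => i _; rewrite mulr_suml.
    by apply: eq_bigr => j _; rewrite mul1r.
  rewrite [X in _ + X](exchange_big_dep xpredT)//=.
  under [X in _ + X]eq_bigr do under eq_bigl do rewrite eq_sym.
  rewrite -[LHS]mulr2n -[LHS]mulr_natl mulr_sumr [RHS]big_mkcond/=.
  apply: eq_bigr => i _; case: ifP => // iA.
  by rewrite big1 ?mulr0// => j _; rewrite /jump iA.
under eq_bigr do rewrite sum_jump//.
rewrite /energy_rhs; set S := \sum_(i in A) _; field.
by rewrite N0 N10.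
Qed.

End generator.

(** * Moments of the energies under a law on the sphere *)

Section borel.
Context (R : realType) (N : nat).

Lemma open_measurable_borel_rV (A : set 'rV[R]_N) : open A ->
  measurable (A : set (borel_rV R N)).
Proof. by move=> oA; apply: sub_sigma_algebra. Qed.

Lemma continuous_measurable_borel_rV (f : 'rV[R]_N -> R) : continuous f ->
  measurable_fun setT (f : borel_rV R N -> R).
Proof.
move=> cf; apply: (measurability _ (RGenOpens.measurableE R)).
move=> _ [_ [x [y ->]] <-]; rewrite setTI; apply: open_measurable_borel_rV.
by apply: open_comp => [v _|]; [exact: cf|exact: itv_open].
Qed.

Lemma continuous_self_measurable_borel_rV (f : 'rV[R]_N -> 'rV[R]_N) : continuous f ->
  measurable_fun setT (f : borel_rV R N -> borel_rV R N).
Proof.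
move=> cf; apply: (@measurability _ _ (borel_rV R N) (borel_rV R N) setT f (@open _)) => //.
move=> _ [A oA <-]; rewrite setTI; apply: open_measurable_borel_rV.
by apply: open_comp => // v _; exact: cf.
Qed.

Lemma continuous_energy (i : 'I_N) : continuous (fun v : 'rV[R]_N => v 0 i ^+ 2).
Proof.
move=> v; rewrite (_ : (fun v : 'rV[R]_N => v 0 i ^+ 2) = (fun v : 'rV[R]_N => v 0 i * v 0 i)).
  have ci := @coord_continuous R 1 N 0 i v.
  exact: (cvgM ci ci).
by apply/funext => w; rewrite expr2.
Qed.

Lemma continuous_energy_prod (A : {set 'I_N}) : continuous (@energy_prod R N A).
Proof.
rewrite (_ : energy_prod A = (fun v : 'rV[R]_N => \prod_(k <- enum A) v 0 k ^+ 2)); last first.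
  by apply/funext => v; rewrite /energy_prod big_enum.
elim: (enum A) => [|k s IH] v.
  rewrite (_ : (fun v : 'rV[R]_N => _) = cst 1); first exact: cst_continuous.
  by apply/funext => w; rewrite big_nil.
rewrite (_ : (fun v : 'rV[R]_N => _) =
  (fun w : 'rV[R]_N => w 0 k ^+ 2 * \prod_(k <- s) w 0 k ^+ 2)).
  exact: (cvgM (@continuous_energy k v) (IH v)).
by apply/funext => w; rewrite big_cons.
Qed.

Lemma continuous_sum_energy : continuous (fun v : 'rV[R]_N => \sum_(i < N) v 0 i ^+ 2).
Proof.
elim: (index_enum 'I_N) => [|k s IH] v.
  rewrite (_ : (fun v : 'rV[R]_N => _) = cst 0); first exact: cst_continuous.
  by apply/funext => w; rewrite big_nil.
rewrite (_ : (fun v : 'rV[R]_N => _) =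
  (fun w : 'rV[R]_N => w 0 k ^+ 2 + \sum_(k <- s) w 0 k ^+ 2)).
  exact: (cvgD (@continuous_energy k v) (IH v)).
by apply/funext => w; rewrite big_cons.
Qed.

Lemma measurable_kac_sphere : measurable (kac_sphere N : set (borel_rV R N)).
Proof.
rewrite -[kac_sphere N]setCK; apply: measurableC; apply: open_measurable_borel_rV.
apply: closed_openC.
rewrite (_ : kac_sphere N = (fun v : 'rV[R]_N => \sum_(i < N) v 0 i ^+ 2) @^-1` [set N%:R])//.
by apply: closed_comp => [v _|]; [exact: continuous_sum_energy|exact: closed_eq].
Qed.

Lemma measurable_energy_prod (A : {set 'I_N}) :
  measurable_fun setT (energy_prod A : borel_rV R N -> R).
Proof. exact: continuous_measurable_borel_rV (@continuous_energy_prod A). Qed.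

Lemma continuous_col_perm (s : 'S_N) : continuous (col_perm s : 'rV[R]_N -> 'rV[R]_N).
Proof.
move=> v A [P /= Pn PA]; exists (fun i j => P i ((s^-1)%g j)).
  by move=> i j; have := Pn i ((s^-1)%g j); rewrite mxE permKV.
move=> w Pw; apply: PA => i j; rewrite mxE.
by have := Pw i (s j); rewrite permK.
Qed.

Lemma energy_prod_col_perm (s : 'S_N) (A : {set 'I_N}) (v : 'rV[R]_N) :
  energy_prod A (col_perm s v) = energy_prod (s @: A) v.
Proof.
rewrite /energy_prod big_imset/=; last by move=> i j _ _; exact: perm_inj.
by apply: eq_bigr => i _; rewrite mxE.
Qed.

Lemma energy_le (i : 'I_N) v : kac_sphere N v -> `|v 0 i ^+ 2| <= N%:R :> R.
Proof.
move=> /= <-; rewrite ger0_norm ?sqr_ge0// (bigD1 i)//= lerDl.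
by apply: sumr_ge0 => j _; exact: sqr_ge0.
Qed.

Lemma energy_prod_le (A : {set 'I_N}) v : kac_sphere N v ->
  `|energy_prod A v| <= \prod_(k in A) N%:R :> R.
Proof.
move=> vS; rewrite normr_prod; apply: ler_prod => i _.
by rewrite normr_ge0 energy_le.
Qed.

Section law.
Variable P : probability (borel_rV R N) R.
Hypothesis PS : P (kac_sphere N) = 1%E.

Definition energy_moment (A : {set 'I_N}) : R :=
  \int[P]_(v in kac_sphere N) energy_prod A v.

Lemma integrable_energy_prod (A : {set 'I_N}) :
  P.-integrable (kac_sphere N) (EFin \o energy_prod A).
Proof.
apply: (@bounded_integrable _ (borel_rV R N) R P _ measurable_kac_sphere
  (energy_prod A) (\prod_(k in A) N%:R)).
  exact: measurable_funTS (measurable_energy_prod A).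
by move=> v vS; exact: energy_prod_le.
Qed.

(** Bundles integrability with the value, so that linearity propagates both at once through the
    nested sums of [energy_rhs]. *)
Let has_integral (f : 'rV[R]_N -> R) (c : R) :=
  P.-integrable (kac_sphere N : set (borel_rV R N)) (EFin \o f)
  /\ \int[P]_(v in kac_sphere N) f v = c.

Let has_integralD f g c d : has_integral f c -> has_integral g d ->
  has_integral (fun v => f v + g v) (c + d).
Proof.
move=> [f1 f2] [g1 g2]; have mS := measurable_kac_sphere; split.
  by have := integrableD mS f1 g1.
by rewrite RintegralD// f2 g2.
Qed.

Let has_integralZ k f c : has_integral f c -> has_integral (fun v => k * f v) (k * c).
Proof.
move=> [f1 f2]; have mS := measurable_kac_sphere; split.
  by have := integrableZl mS k f1.
by rewrite RintegralZl// f2.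
Qed.

Let has_integral_sum (I : Type) (r : seq I) (Q : pred I) (f : I -> 'rV[R]_N -> R) c :
  (forall i, has_integral (f i) (c i)) ->
  has_integral (fun v => \sum_(i <- r | Q i) f i v) (\sum_(i <- r | Q i) c i).
Proof.
move=> fc; elim: r => [|i r IH].
  rewrite (_ : (fun v => _) = (fun v => 0 * energy_prod finset.set0 v)); last first.
    by apply/funext => v; rewrite big_nil mul0r.
  rewrite big_nil -[0 in X in has_integral _ X](mul0r (energy_moment finset.set0)).
  by apply: has_integralZ; split => //; exact: integrable_energy_prod.
rewrite big_cons; case: ifP => Qi.
  rewrite (_ : (fun v => _) = (fun v => f i v + \sum_(i <- r | Q i) f i v)).
    exact: has_integralD.
  by apply/funext => v; rewrite big_cons Qi.
by rewrite (_ : (fun v => _) = (fun v => \sum_(i <- r | Q i) f i v))//;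
  apply/funext => v; rewrite big_cons Qi.
Qed.

Lemma Rintegral_energy_rhs (A : {set 'I_N}) :
  \int[P]_(v in kac_sphere N) energy_rhs ((@energy_prod R N) ^~ v) A
  = energy_rhs energy_moment A.
Proof.
have hE B : has_integral (energy_prod B) (energy_moment B).
  by split => //; exact: integrable_energy_prod.
suff [] : has_integral (fun v => energy_rhs ((@energy_prod R N) ^~ v) A)
  (energy_rhs energy_moment A) by [].
apply: has_integralZ; apply: has_integral_sum => i.
apply: has_integralD.
  by apply: has_integralD; apply: has_integralZ => //; exact: has_integral_sum.
by rewrite -mulNr; under eq_fun do rewrite -mulNr; exact: has_integralZ.
Qed.

Lemma sum_energy_moment1 : \sum_(i < N) energy_moment [set i] = N%:R.
Proof.
have [_ <-] : has_integral (fun v => \sum_(i < N) energy_prod [set i] v)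
    (\sum_(i < N) energy_moment [set i]).
  by apply: has_integral_sum => i; split => //; exact: integrable_energy_prod.
rewrite (_ : Rintegral _ _ _ = \int[P]_(v in kac_sphere N) (cst (N%:R : R) v)); last first.
  apply: eq_Rintegral => v; rewrite inE /kac_sphere/= => <-.
  by apply: eq_bigr => i _; rewrite /energy_prod big_set1.
rewrite (Rintegral_cst _ measurable_kac_sphere).
by rewrite [X in fine X]PS mulr1.
Qed.

Lemma energy_moment_perm (s : 'S_N) (A : {set 'I_N}) : symmetric_law P ->
  energy_moment (s @: A) = energy_moment A.
Proof.
move=> symP; rewrite /energy_moment -!(Rintegral_full measurable_kac_sphere PS); last 2 first.
- exact: measurable_energy_prod.
- exact: measurable_energy_prod.
have mc := continuous_self_measurable_borel_rV (@continuous_col_perm s).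
congr fine; transitivity (\int[pushforward P (col_perm s : borel_rV R N -> borel_rV R N)]_v
    (energy_prod A v)%:E)%E.
  rewrite (ge0_integral_pushforward mc)//=.
  - by rewrite preimage_setT; apply: eq_integral => v _ /=; rewrite energy_prod_col_perm.
  - by apply/measurable_EFinP; exact: measurable_energy_prod.
  - by move=> v _; rewrite lee_fin prodr_ge0// => i _; exact: sqr_ge0.
by apply: eq_measure_integral => B mB _; exact: symP.
Qed.

End law.
End borel.

(** * Differential inequalities on the half-line *)

Section halfline.
Context (R : realType).
Implicit Types u v du dv : R -> R.

(* At 0 only right continuity is kept: this is all that monotonicity arguments need. *)
Definition halfline_derivative u du :=
  (forall t : R, 0 < t -> is_derive t (1 : R) u (du t)) /\ u @ 0^'+ --> u 0.

Lemma has_derivative_halflineW u du :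
  (forall t, 0 <= t -> has_derivative_halfline u t (du t)) ->
  halfline_derivative u du.
Proof.
move=> H; split.
  move=> t t0.
  have Q : h^-1 *: ((u \o shift t) (h *: (1 : R)) - u t) @[h --> (0 : R)^'] --> du t.
    apply/cvgrPdist_lt => e e0.
    have := H t (ltW t0); move/cvgrPdist_lt => /(_ e e0).
    rewrite /within/= /dnbhs /within/= => -[d d0 Hd].
    (* A radius at most [t] keeps [h + t] in the half-line, so the restricted limit is an ordinary
       two-sided one. *)
    exists (Num.min d t); first by rewrite /= lt_min d0 t0.
    move=> h /=; rewrite sub0r normrN lt_min => /andP[hd ht] h0.
    have := Hd (h + t); rewrite /= opprD addrC subrK normrN => /(_ hd).
    rewrite -subr_eq0 addrK => /(_ h0).
    have -> : 0 <= h + t.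
      by have := ltW ht; rewrite ler_norml => /andP[]; lra.
    by move=> /(_ isT); rewrite /GRing.scale/= mulr1.
  split; first by apply/cvg_ex; exists (du t).
  exact: cvg_lim Q.
have Q : (s - 0)^-1 * (u s - u 0) @[s --> 0^'+] --> du 0.
  apply: cvg_trans (H 0 (lexx _)).
  move=> A; rewrite /within/= /nbhs/= /dnbhs /within/= => -[d d0 Hd].
  exists d => // s /= sd s0; apply: Hd => //; last exact: ltW.
  by rewrite gt_eqF.
have S0 : s - 0 @[s --> (0:R)^'+] --> (0 : R).
  under eq_fun do rewrite subr0.
  exact: (cvg_at_right_filter cvg_id).
have Q2 : (s - 0) * ((s - 0)^-1 * (u s - u 0)) + u 0 @[s --> (0 : R)^'+] -->
    0 * du 0 + u 0.
  exact: cvgD (cvgM S0 Q) (cvg_cst _).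
rewrite mul0r add0r in Q2; apply: (cvg_trans _ Q2); apply: near_eq_cvg.
near=> s.
have s0 : 0 < s by near: s; exact: nbhs_right_gt.
by rewrite /= subr0 mulrA divff ?gt_eqF// mul1r subrK.
Unshelve. all: by end_near. Qed.

Lemma halfline_derivative_eq u v du dv : halfline_derivative u du ->
  u =1 v -> (forall t, 0 < t -> du t = dv t) -> halfline_derivative v dv.
Proof.
by move=> [du1 du2] /funext <- dd; split => // t t0; rewrite -dd//; exact: du1.
Qed.

Lemma halfline_derivative_cst (k : R) : halfline_derivative (cst k) (cst 0).
Proof. by split => [t _|]; [exact: is_derive_cst|exact: cvg_cst]. Qed.

Lemma halfline_derivativeD u v du dv :
  halfline_derivative u du -> halfline_derivative v dv ->
  halfline_derivative (fun t => u t + v t) (fun t => du t + dv t).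
Proof.
move=> [u1 u2] [v1 v2]; split; last exact: (cvgD u2 v2).
by move=> t t0; exact: (is_deriveD (u1 t t0) (v1 t t0)).
Qed.

Lemma halfline_derivativeM u v du dv :
  halfline_derivative u du -> halfline_derivative v dv ->
  halfline_derivative (fun t => u t * v t) (fun t => du t * v t + u t * dv t).
Proof.
move=> [u1 u2] [v1 v2]; split; last exact: (cvgM u2 v2).
move=> t t0; apply: (eq_is_derive (is_deriveM (u1 t t0) (v1 t t0))) => //.
by rewrite addrC; congr (_ + _); rewrite // mulrC.
Qed.

Lemma halfline_derivativeZ k u du : halfline_derivative u du ->
  halfline_derivative (fun t => k * u t) (fun t => k * du t).
Proof.
move=> hu; apply: (halfline_derivative_eq
  (halfline_derivativeM (halfline_derivative_cst k) hu)) => //.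
by move=> t _; rewrite mul0r add0r.
Qed.

Lemma halfline_derivativeB u v du dv :
  halfline_derivative u du -> halfline_derivative v dv ->
  halfline_derivative (fun t => u t - v t) (fun t => du t - dv t).
Proof.
move=> hu hv.
apply: (halfline_derivative_eq (halfline_derivativeD hu (halfline_derivativeZ (-1) hv))) => t.
  by rewrite mulN1r.
by rewrite mulN1r.
Qed.

Lemma halfline_derivative_sum (I : Type) (r : seq I) (u du : I -> R -> R) :
  (forall i, halfline_derivative (u i) (du i)) ->
  halfline_derivative (fun t => \sum_(i <- r) u i t) (fun t => \sum_(i <- r) du i t).
Proof.
move=> hu; elim: r => [|i r IH].
  by apply: (halfline_derivative_eq (halfline_derivative_cst 0)) => t; rewrite big_nil.
by apply: (halfline_derivative_eq (halfline_derivativeD (hu i) IH)) => t; rewrite big_cons.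
Qed.

Lemma halfline_derivative_derivable u du : (forall t : R, is_derive t (1 : R) u (du t)) ->
  halfline_derivative u du.
Proof.
move=> hu; split; first by move=> t _; exact: hu.
apply: cvg_at_right_filter; apply: differentiable_continuous; apply/derivable1_diffP.
exact: (ex_derive (is_derive := hu 0)).
Qed.

Lemma halfline_derivative_id : halfline_derivative id (cst 1).
Proof. by apply: halfline_derivative_derivable => t; exact: is_derive_id. Qed.

Lemma halfline_derivative_expR (k : R) :
  halfline_derivative (fun t => expR (k * t)) (fun t => k * expR (k * t)).
Proof.
apply: halfline_derivative_derivable => t.
have D : is_derive t (1 : R) (fun t : R => k * t) k.
  apply: (eq_is_derive (is_deriveZ k (is_derive_id t (1 : R)))) => //.
  by rewrite [k%:A]mulr1.
apply: (eq_is_derive (is_derive1_comp (is_derive_expR (k * t)) D)) => //.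
by rewrite mulrC.
Qed.

Lemma halfline_ge0 u du : halfline_derivative u du -> 0 <= u 0 ->
  (forall t, 0 < t -> 0 <= du t) -> forall t, 0 <= t -> 0 <= u t.
Proof.
move=> [u1 u2] u0 du0 t t0; apply: (le_trans u0).
have ux x : x \in `]0, +oo[ -> 0 < x by rewrite in_itv/= andbT.
apply: (@ger0_derive1_ndecry _ u 0) => //.
- by move=> x /ux x0; exact: (ex_derive (is_derive := u1 x x0)).
- by move=> x /ux x0; rewrite derive1E (derive_val (is_derive := u1 x x0)) du0.
- apply: derivable_oy_Rcontinuous_within_itvcy; split => // x /ux x0.
  exact: (ex_derive (is_derive := u1 x x0)).
Qed.

(** Integrating factor: exp(lambda t) (H - e w) is nondecreasing from a nonnegative value, for both
    signs e = 1 and e = -1. *)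
Lemma halfline_comparison (lambda : R) (w dw H dH : R -> R) :
  halfline_derivative w dw -> halfline_derivative H dH ->
  `|w 0| <= H 0 ->
  (forall t, 0 < t -> `|dw t + lambda * w t| <= dH t + lambda * H t) ->
  forall t, 0 <= t -> `|w t| <= H t.
Proof.
move=> hw hH w0 wH t t0.
have key (e : R) : `|e| = 1 -> 0 <= H t - e * w t.
  move=> e1.
  have hf := halfline_derivativeM (halfline_derivative_expR lambda)
    (halfline_derivativeB hH (halfline_derivativeZ e hw)).
  have := halfline_ge0 hf; rewrite /= mulr0 expR0 mul1r => /(_ _ _ t t0).
  rewrite pmulr_rge0 ?expR_gt0//; apply.
  - by rewrite subr_ge0 (le_trans (ler_norm _))// normrM e1 mul1r.
  - move=> s s0.
    rewrite (_ : _ + _ = expR (lambda * s) *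
      (lambda * (H s - e * w s) + (dH s - e * dw s))); last by ring.
    rewrite mulr_ge0 ?expR_ge0//.
    have : e * (dw s + lambda * w s) <= dH s + lambda * H s.
      by rewrite (le_trans (ler_norm _))// normrM e1 mul1r wH.
    lra.
rewrite ler_norml; apply/andP; split.
  by have := key (-1); rewrite normrN normr1 => /(_ erefl); lra.
by have := key 1; rewrite normr1 => /(_ erefl); lra.
Qed.

(** Gronwall for the sum of squares: each of the [#|I|] coordinates contributes at most 2 K times
    that sum to its derivative, so after multiplication by exp(- L t) it is nonincreasing from 0. *)
Lemma halfline_linear_uniqueness (I : finType) (x dx : I -> R -> R) (K : R) :
  (forall i, halfline_derivative (x i) (dx i)) ->
  (forall i, x i 0 = 0) ->
  (forall i t, 0 < t -> x i t * dx i t <= K * \sum_j x j t ^+ 2) ->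
  forall i t, 0 <= t -> x i t = 0.
Proof.
move=> hx x0 xK i t t0.
pose L := #|I|%:R * (2 * K).
have hE := halfline_derivative_sum (index_enum I)
  (fun j => halfline_derivativeM (hx j) (hx j)).
have hf := halfline_derivativeZ (-1)
  (halfline_derivativeM (halfline_derivative_expR (- L)) hE).
have E0 s : 0 <= \sum_(j in I) x j s * x j s.
  by apply: sumr_ge0 => j _; rewrite -expr2 sqr_ge0.
have Ele0 : 0 <= -1 * (expR (- L * t) * \sum_(j in I) x j t * x j t).
  apply: (halfline_ge0 hf _ _ t0).
    by rewrite big1 ?mulr0// => j _; rewrite x0 mulr0.
  move=> s s0; rewrite mulN1r oppr_ge0 -mulrA mulrCA -mulrDr.
  rewrite pmulr_rle0 ?expR_gt0// mulNr addrC subr_le0.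
  rewrite [leRHS](_ : _ = \sum_(j in I) (2 * (K * \sum_k x k s ^+ 2))).
    apply: ler_sum => j _; rewrite (_ : _ + _ = 2 * (x j s * dx j s)); last by ring.
    by rewrite ler_wpM2l// xK.
  rewrite [RHS]sumr_const -[RHS]mulr_natl /L -!mulrA; do 3 congr (_ * _).
have /eqP : \sum_(j in I) x j t * x j t = 0.
  apply/eqP; rewrite eq_le E0 andbT.
  by move: Ele0; rewrite mulN1r oppr_ge0 pmulr_rle0 ?expR_gt0.
rewrite psumr_eq0; last by move=> j _; rewrite -expr2 sqr_ge0.
by move=> /allP/(_ i (mem_index_enum i)); rewrite -expr2 sqrf_eq0 => /eqP.
Qed.

End halfline.

(** * Evolution of the moments *)

Section energy_rhs.
Context (R : realType) (N : nat).
Implicit Types (x y : {set 'I_N} -> R) (A B : {set 'I_N}).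

Lemma energy_rhsB x y A :
  energy_rhs (fun B => x B - y B) A = energy_rhs x A - energy_rhs y A.
Proof.
rewrite /energy_rhs -mulrBr -sumrB; congr (_ * _); apply: eq_bigr => i _.
rewrite sumrB; ring.
Qed.

Lemma energy_rhs_perm (s : 'S_N) x A :
  energy_rhs (fun B => x (s @: B)) A = energy_rhs x (s @: A).
Proof.
have imD1 i : s @: (A :\ i) = s @: A :\ s i.
  apply/setP => k; rewrite -[k](permKV s) !inE !(mem_imset _ _ (@perm_inj _ s)).
  by rewrite !inE (inj_eq (@perm_inj _ s)).
have imU1 B i : s @: (i |: B) = s i |: s @: B by rewrite imsetU1.
rewrite /energy_rhs big_imset/=; last by move=> i j _ _; exact: perm_inj.
congr (_ * _); apply: eq_bigr => i iA; rewrite card_imset; last exact: perm_inj.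
rewrite imD1; congr (_ + _ * _ - _).
rewrite [RHS](reindex_inj (@perm_inj _ s))/=.
by apply: eq_big => [j|j _]; [rewrite mem_imset; last exact: perm_inj|rewrite imU1 imD1].
Qed.

(** A crude Lipschitz constant in the sup norm; its size is irrelevant, since it only feeds the
    uniqueness argument for the moment system. *)
Lemma energy_rhs_le x A (e : R) : (1 < N)%N -> (forall B, `|x B| <= e) ->
  `|energy_rhs x A| <= (N%:R - 1)^-1 *
    (N%:R * (N%:R / 4 + 3 / 4 * N%:R + (1 + 2 * N%:R))) * e.
Proof.
move=> N1 xe.
have e0 : 0 <= e by apply: le_trans (xe finset.set0).
have N1R : 1 < N%:R :> R by rewrite ltr1n.
have AN : #|A|%:R <= N%:R :> R by rewrite ler_nat -[leqRHS]card_ord max_card.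
have r0 : 0 <= (N%:R - 1)^-1 :> R by rewrite invr_ge0 subr_ge0 ltW.
rewrite normrM (ger0_norm r0) -[leRHS]mulrA ler_wpM2l// -[leRHS]mulrA.
apply: (le_trans (ler_norm_sum _ _ _)).
apply: (@le_trans _ _ (\sum_(i in A) (N%:R / 4 + 3 / 4 * N%:R + (1 + 2 * N%:R)) * e)); last first.
  rewrite sumr_const -[leLHS]mulr_natl ler_wpM2r//; apply: mulr_ge0 => //; lra.
apply: ler_sum => i iA.
have A1 : 1 <= #|A|%:R :> R by rewrite (ler_nat R 1) card_gt0; apply/finset.set0Pn; exists i.
apply: (le_trans (ler_normB _ _)); rewrite [leRHS]mulrDl; apply: lerD.
  apply: (le_trans (ler_normD _ _)); rewrite [leRHS]mulrDl; apply: lerD.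
    by rewrite normrM ger0_norm ?ler_wpM2l ?xe//; lra.
  rewrite normrM ger0_norm; last by lra.
  rewrite -!mulrA; do 2 (apply: ler_wpM2l; first by lra).
  apply: (le_trans (ler_norm_sum _ _ _)).
  apply: (@le_trans _ _ (\sum_(j | j \notin A) e)); first by apply: ler_sum.
  rewrite sumr_const -[leLHS]mulr_natl ler_wpM2r// ler_nat -[leqRHS]card_ord.
  exact: max_card.
rewrite normrM; apply: ler_pM => //.
rewrite ger0_norm; lra.
Qed.

End energy_rhs.

(** Exchanging an element of [A :\: B] with one of [B :\: A] by a transposition shrinks [A :\: B];
    induction on its size. *)
Lemma perm_imset_eq (T : finType) (A B : {set T}) : #|A| = #|B| ->
  exists s : {perm T}, s @: A = B.
Proof.
have [m] := ubnP #|A :\: B|; elim: m A => // m IH A ABm AB.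
have [AB0|[a]] := set_0Vmem (A :\: B).
  exists 1%g; rewrite (eq_imset (g := id)); last by move=> x; rewrite perm1.
  rewrite imset_id; apply/eqP; rewrite eqEcard AB leqnn andbT.
  by rewrite -finset.setD_eq0 AB0.
move=> aAB.
have [BA0|[b bBA]] := set_0Vmem (B :\: A).
  have := cardsID B A; have := cardsID A B.
  rewrite BA0 cards0 addn0 finset.setIC AB => -> /eqP.
  rewrite -[X in _ == X]addn0 eqn_add2l cards_eq0 => /eqP AB0.
  by move: aAB; rewrite AB0 inE.
move: aAB bBA; rewrite !inE => /andP[aB aA] /andP[bA bB].
have tpA : tperm a b @: A = b |: A :\ a.
  apply/setP => x; have -> : (x \in tperm a b @: A) = (tperm a b x \in A).
    by rewrite -{1}(tpermK a b x) (mem_imset _ _ (@perm_inj _ _)).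
  rewrite !inE; case: (tpermP a b x) => [->|->|/eqP xa /eqP xb].
  - by rewrite (negPf bA) eqxx orbF; apply/esym/eqP => ab; rewrite ab bB in aB.
  - by rewrite eqxx aA.
  - by rewrite (negPf xb) xa.
have [||s sA] := IH (tperm a b @: A).
- rewrite tpA; rewrite (cardsD1 a (A :\: B)) !inE aB aA/= add1n ltnS in ABm.
  apply: leq_trans ABm; rewrite ltnS; apply: subset_leq_card; apply/fintype.subsetP => x.
  rewrite !inE => /andP[xB] /predU1P[xb|/andP[-> ->]]; last by rewrite xB.
  by rewrite xb bB in xB.
- by rewrite card_imset//; exact: perm_inj.
exists (tperm a b * s)%g; rewrite -sA -imset_comp.
by apply: eq_imset => x; rewrite permM.
Qed.

Section evolution.
Context (R : realType) (N : nat) (F : R -> probability (borel_rV R N) R).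
Hypotheses (N1 : (1 < N)%N) (evF : kac_evolution F) (symF : symmetric_law (F 0)).

Local Notation M t := (energy_moment (F t)).

Lemma energy_moment_derivative (A : {set 'I_N}) :
  halfline_derivative (fun t => M t A) (fun t => energy_rhs (M t) A).
Proof.
apply: has_derivative_halflineW => t t0; have [_ FE] := evF.
have cA : {within kac_sphere N, continuous (@energy_prod R N A)}.
  exact: continuous_subspaceT (@continuous_energy_prod R N A).
have := FE _ cA t t0.
rewrite -Rintegral_energy_rhs.
have -> : \int[F t]_(v in kac_sphere N) kac_generator (energy_prod A) v =
    \int[F t]_(v in kac_sphere N) energy_rhs ((@energy_prod R N) ^~ v) A.
  apply: eq_Rintegral => v; rewrite inE => vS.
  exact: kac_generator_energy_prod.
by [].
Qed.

(** The difference between permuted and original moments solves the same linear system, because the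
    system is permutation equivariant, and it vanishes at time 0; uniqueness makes it vanish for all
    times. *)
Lemma energy_moment_perm_invariant (s : 'S_N) (A : {set 'I_N}) t : 0 <= t ->
  M t (s @: A) = M t A.
Proof.
move=> t0; apply/eqP; rewrite -subr_eq0; apply/eqP; move: A t t0.
have hD (A : {set 'I_N}) : halfline_derivative (fun t => M t (s @: A) - M t A)
    (fun t => energy_rhs (fun B => M t (s @: B) - M t B) A).
  apply: (halfline_derivative_eq (halfline_derivativeB (energy_moment_derivative (s @: A))
    (energy_moment_derivative A))) => // t _.
  by rewrite energy_rhsB energy_rhs_perm.
apply: (halfline_linear_uniqueness (K := (N%:R - 1)^-1 *
    (N%:R * (N%:R / 4 + 3 / 4 * N%:R + (1 + 2 * N%:R)))) hD).
  by move=> A; rewrite energy_moment_perm ?subrr//; exact: evF.1.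
move=> A t t0; set K := _ * (_ * _).
set x := fun B : {set 'I_N} => M t (s @: B) - M t B.
set E := \sum_j _.
have E0 : 0 <= E by apply: sumr_ge0 => j _; exact: sqr_ge0.
have xE B : `|x B| <= Num.sqrt E.
  rewrite -sqrtr_sqr ler_wsqrtr// /E (bigD1 B)//= lerDl.
  by apply: sumr_ge0 => j _; exact: sqr_ge0.
have -> : K * E = Num.sqrt E * (K * Num.sqrt E).
  by rewrite -{1}(sqr_sqrtr E0) expr2 mulrCA.
apply: (le_trans (ler_norm _)); rewrite normrM.
by apply: ler_pM => //; [exact: xE|exact: energy_rhs_le].
Qed.

Lemma energy_moment_card (A B : {set 'I_N}) t : 0 <= t -> #|A| = #|B| -> M t A = M t B.
Proof.
by move=> t0 /perm_imset_eq[s <-]; rewrite energy_moment_perm_invariant.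
Qed.

Definition initial_set (k : nat) : {set 'I_N} := [set i : 'I_N | (i < k)%N].

Lemma card_initial_set k : (k <= N)%N -> #|initial_set k| = k.
Proof.
move=> kN; have -> : initial_set k = [set widen_ord kN i | i : 'I_k].
  apply/setP => i; rewrite inE; apply/idP/imsetP => [ik|[j _ ->]//=].
  by exists (Ordinal ik) => //; apply: val_inj.
by rewrite card_imset ?card_ord// => i j /(congr1 val) /= /val_inj.
Qed.

(** The coefficient m_k / k! of the generating series M; the initial set is a representative of all
    sets of size [k], whose moments agree by exchangeability. *)
Definition moment_coef (t : R) (k : nat) : R := M t (initial_set k) / k`!%:R.

Lemma moment_coefE (A : {set 'I_N}) t : 0 <= t -> M t A = moment_coef t #|A| * (#|A|)`!%:R.
Proof.
move=> t0; rewrite /moment_coef divfK ?pnatr_eq0 -?lt0n ?fact_gt0//.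
apply: energy_moment_card => //; rewrite card_initial_set//.
by rewrite -[leqRHS]card_ord max_card.
Qed.

Lemma moment_coef0 t : 0 <= t -> moment_coef t 0 = 1.
Proof.
move=> t0; rewrite /moment_coef fact0 divr1.
have -> : initial_set 0 = finset.set0 by apply/setP => i; rewrite !inE.
rewrite /energy_moment.
under eq_Rintegral do rewrite /energy_prod big_set0.
rewrite (Rintegral_cst _ (@measurable_kac_sphere R N)) mul1r.
by rewrite [X in fine X](evF.1 t t0).
Qed.

(** Exchangeability shares the total energy N equally among the N particles. This fixes the first
    cumulant and starts the induction on the hierarchy. *)
Lemma moment_coef1 t : 0 <= t -> moment_coef t 1 = 1.
Proof.
move=> t0; have N0 : N%:R != 0 :> R by rewrite pnatr_eq0; lia.
apply: (mulfI N0); rewrite mulr1 -[RHS](sum_energy_moment1 (evF.1 t t0)).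
rewrite (eq_bigr (fun=> moment_coef t 1)).
  by rewrite sumr_const card_ord -[RHS]mulr_natl.
by move=> i _; rewrite moment_coefE// cards1 mulr1.
Qed.

Lemma moment_coef_derivative0 : halfline_derivative (moment_coef ^~ 0) (cst 0).
Proof.
apply: (halfline_derivative_eq (energy_moment_derivative (initial_set 0))) => t.
  by rewrite /moment_coef fact0 divr1.
move=> _; rewrite /energy_rhs big1 ?mulr0// => i.
by rewrite inE.
Qed.

(** All moments of one size coincide, so gain and loss at size k + 1 combine: 1/4 + 3k/4 + (N - k -
    1) - 3(N - k - 1)/4 = (N + 2k)/4. *)
Lemma moment_coef_derivative k : (k < N)%N ->
  halfline_derivative (moment_coef ^~ k.+1)
    (fun t => (4 * (N%:R - 1))^-1 *
      (N%:R * moment_coef t k - k.+1%:R * (N%:R + 2 * k%:R) * moment_coef t k.+1)).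
Proof.
move=> kN.
have N10 : N%:R - 1 != 0 :> R by rewrite subr_eq0 (eqr_nat R N 1); lia.
apply: (halfline_derivative_eq (halfline_derivativeZ (k.+1)`!%:R^-1
    (energy_moment_derivative (initial_set k.+1)))) => t.
  by rewrite mulrC.
move=> t0; have tge0 := ltW t0.
have cI := card_initial_set kN.
rewrite /energy_rhs cI (eq_bigr (fun _ => N%:R / 4 * (moment_coef t k * k`!%:R)
  + 3 / 4 * ((N - k.+1)%:R * (moment_coef t k.+1 * (k.+1)`!%:R))
  - (4^-1 + 3 / 4 * (k.+1%:R - 1) + (N%:R - k.+1%:R)) * (moment_coef t k.+1 * (k.+1)`!%:R))).
  rewrite sumr_const cI -[X in _^-1 * (_ * X)]mulr_natl natrB// factS natrM.
  have k0 : k`!%:R != 0 :> R by rewrite pnatr_eq0 -lt0n fact_gt0.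
  have k1 : 1 + k%:R != 0 :> R by rewrite nat1r pnatr_eq0.
  field; by rewrite N10 k0 k1.
move=> i iI.
have cD : #|initial_set k.+1 :\ i| = k.
  by apply/eqP; rewrite -(eqn_add2l 1) -[X in (X + _)%N]/(true : nat) -iI -cardsD1 cI.
rewrite !moment_coefE// cI cD; congr (_ + _ * _ - _).
rewrite (eq_bigr (fun _ => moment_coef t k.+1 * (k.+1)`!%:R)).
  rewrite sumr_const -[LHS]mulr_natl; congr (_%:R * _).
  apply: (@addnI k.+1); rewrite subnKC// -[RHS]card_ord -(cardsC (initial_set k.+1)) cI.
  congr (_ + _)%N.
  by apply: eq_card => j; rewrite [RHS]inE.
move=> j jI; have jD : j \notin initial_set k.+1 :\ i.
  by rewrite in_setD1 negb_and jI orbT.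
by rewrite moment_coefE// cardsU1 cD jD add1n.
Qed.

End evolution.

(** * Evolution and bounds of the cumulants *)

Section cumulant_evolution.
Context (R : realType) (N : nat) (F : R -> probability (borel_rV R N) R).
Hypotheses (N1 : (1 < N)%N) (evF : kac_evolution F) (symF : symmetric_law (F 0)).

Lemma nr_cumulantE t n (le_nN : (n <= N)%N) : 0 <= t -> (0 < n)%N ->
  nr_cumulant (F t) le_nN =
  log_deriv_coef (moment_coef F t) n.-1 * (n.-1)`!%:R.
Proof.
move=> t0 n0; have FS := evF.1 t t0; rewrite /nr_cumulant.
apply: (@joint_cumulantE _ (borel_rV R N) R (F t) _ (@measurable_kac_sphere R N) FS _ _ N%:R) => //.
- move=> i; exact: (continuous_measurable_borel_rV (@continuous_energy R N _)).
- by move=> i v vS; exact: energy_le.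
- exact: moment_coef0.
move=> s us; pose A : {set 'I_N} := (widen_ord le_nN @: finset (fun i => i \in s)).
have inj : injective (widen_ord le_nN) by move=> i j /(congr1 val) /= /val_inj.
have cA : #|A| = size s by rewrite card_imset// cardsE; exact/card_uniqP.
rewrite -cA -(moment_coefE N1 evF symF A t0) /energy_moment /tilted_moment.
apply: eq_Rintegral => v _.
rewrite (_ : \sum_(i < n) _ = 0); last by rewrite big1// => i _; rewrite mxE mul0r.
rewrite expR0 mulr1 /energy_prod big_imset/=; last by move=> i j _ _; exact: inj.
by rewrite [LHS]big_uniq//=; apply: eq_bigl => i; rewrite inE.
Qed.

Let a t := log_deriv_coef (moment_coef F t).

Lemma log_deriv_moment0 t : 0 <= t -> a t 0 = 1.
Proof.
by move=> t0; rewrite /a log_deriv_coefE big_ord0 subr0 mul1r moment_coef1.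
Qed.

Let r : R := (4 * (N%:R - 1))^-1.

Let db k t := if k is j.+1 then
  r * (N%:R * moment_coef F t j - k%:R * (N%:R + 2 * j%:R) * moment_coef F t k) else 0.

Let hb k : (k <= N)%N -> halfline_derivative (moment_coef F ^~ k) (db k).
Proof.
case: k => [_|k kN]; first exact: moment_coef_derivative0.
exact: moment_coef_derivative.
Qed.

Let da k t := 'D_1 (a ^~ k) t.

(** The recursion [log_deriv_coefE] expresses [a k] by moments and lower coefficients, so
    differentiability and the differentiated recursion follow together by strong induction. *)
Let ha k : (k < N)%N -> halfline_derivative (a ^~ k) (da k) /\
  forall t, 0 < t -> da k t = k.+1%:R * db k.+1 t -
    \sum_(i < k) (da i t * moment_coef F t (k - i)%N + a t i * db (k - i)%N t).
Proof.
elim/ltn_ind: k => k IH kN.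
have H : halfline_derivative (a ^~ k) (fun t => k.+1%:R * db k.+1 t -
    \sum_(i < k) (da i t * moment_coef F t (k - i)%N + a t i * db (k - i)%N t)).
  apply: (halfline_derivative_eq (halfline_derivativeB
    (halfline_derivativeZ k.+1%:R (hb kN))
    (halfline_derivative_sum (index_enum 'I_k) (fun i : 'I_k => halfline_derivativeM
      (IH i (ltn_ord i) (ltn_trans (ltn_ord i) kN)).1
      (hb (leq_trans (leq_subr i k) (ltnW kN))))))) => // t.
  by rewrite /a log_deriv_coefE.
have E t : 0 < t -> da k t = k.+1%:R * db k.+1 t -
    \sum_(i < k) (da i t * moment_coef F t (k - i)%N + a t i * db (k - i)%N t).
  by move=> t0; rewrite /da (derive_val (is_derive := H.1 t t0)).
by split => //; apply: (halfline_derivative_eq H) => // t t0; rewrite E.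
Qed.

Lemma log_deriv_moment_derivative k : (k.+1 < N)%N ->
  halfline_derivative (a ^~ k.+1) (fun t => - (k.+2%:R * (r *
    ((N%:R + 2 * k.+1%:R) * a t k.+1 + 2 * \sum_(i < k.+1) a t i * a t (k - i)%N)))).
Proof.
move=> kN; apply: (halfline_derivative_eq (ha kN).1) => // t t0.
have b0 : moment_coef F t 0 = 1 by apply: moment_coef0 => //; exact: ltW.
apply: (@log_derivative_flow R N r N%:R (a t) (moment_coef F t) (da ^~ t) (db ^~ t)) => //.
- by move=> j jN; rewrite log_deriv_coef_conv.
- move=> j jN; rewrite big_ord_recr/= subnn b0 mulr1 mulr0 addr0.
  by rewrite (ha jN).2// addrCA subrr addr0.
Qed.

End cumulant_evolution.

(** * Inductive bounds for the rescaled cumulant hierarchy *)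

Section hierarchy_bound.
Context (R : realType).
Variables (p g q B : R) (K n : nat) (a : nat -> R -> R).
Hypotheses (p1 : 1 < p) (g0 : 0 < g) (q1 : 1 <= q) (B1 : 1 <= B) (nK : (n <= K)%N).
(** In the application p = N, g = N^alpha and q = N^c. After [a k] is rescaled by g^k, the quadratic
    forcing carries the small factor [delta], of order N^(alpha - 1). *)
Let delta := g / (p - 1).
Hypothesis small1 : 16 * K%:R * delta <= 1.
Hypothesis small2 : 32 * K%:R ^+ 2 * q ^+ K <= expR (32 * K%:R ^+ 2 * delta)^-1.
Hypothesis a0 : forall t, 0 <= t -> a 0 t = 1.
Hypothesis da : forall k, (k.+1 < n)%N ->
  halfline_derivative (a k.+1) (fun t => - (k.+2%:R * ((4 * (p - 1))^-1 *
    ((p + 2 * k.+1%:R) * a k.+1 t + 2 * \sum_(i < k.+1) a i t * a (k - i)%N t)))).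
Hypothesis init : forall k, (k < n)%N -> `|a k 0| * g ^+ k <= B ^+ k.+1 * q ^+ k.

Let e t : R := expR (- (t / 4)).
(** Profile of the cumulant of order k + 1: initial size q^k, damped at rate (k + 1) / 4. *)
Let u k t : R := e t ^+ k.+1 * q ^+ k.

Let delta_gt0 : 0 < delta.
Proof. by rewrite divr_gt0// subr_gt0. Qed.

Let e_gt0 t : 0 < e t. Proof. exact: expR_gt0. Qed.

Let e_le1 t : 0 <= t -> e t <= 1.
Proof. by move=> t0; rewrite -expR0 ler_expR oppr_le0 divr_ge0. Qed.

Let u_gt0 k t : 0 < u k t.
Proof. by rewrite mulr_gt0// exprn_gt0// (lt_le_trans ltr01). Qed.

(* Once [t] exceeds 1 / (4 K^2 delta), the exponential decay beats all powers of [q]. *)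
Lemma time_growth_bound k t : (k < K)%N -> 0 <= t ->
  2 * K%:R ^+ 2 * delta * t * u k t <= (u k t + 1) / 2.
Proof.
move=> kK t0; have u0 := u_gt0 k t.
have K0 : 0 < K%:R :> R by rewrite ltr0n (leq_trans _ kK).
have K20 : 0 < K%:R ^+ 2 :> R by rewrite exprn_gt0.
have [small|large] := leP (4 * K%:R ^+ 2 * delta * t) 1.
  suff : 4 * K%:R ^+ 2 * delta * t * u k t <= 1 * u k t by lra.
  by rewrite ler_wpM2r// ltW.
suff : 4 * K%:R ^+ 2 * delta * t * u k t <= 1 by lra.
have d1 : delta <= 1.
  have K1 : 1 <= K%:R :> R by rewrite (ler_nat _ 1) (leq_trans _ kK).
  have : delta * 1 <= delta * K%:R by rewrite ler_wpM2l// ltW.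
  have := small1; have := delta_gt0; nra.
(* The decay exp(- t / 4) is spent in two halves: one factor exp(t / 8) absorbs [t], the other
   absorbs the constant and [q ^+ K] through [small2]. *)
have te : t <= 8 * expR (t / 8).
  have := expR_ge1Dx (t / 8); lra.
have qK0 : 0 <= q ^+ K by rewrite exprn_ge0// (le_trans ler01 q1).
have ue : u k t <= expR (- (t / 4)) * q ^+ K.
  have ek : e t ^+ k <= 1 by rewrite exprn_ile1 ?e_le1// ltW.
  rewrite /u; apply: ler_pM; rewrite ?exprn_ge0 ?(le_trans ler01 q1)//.
  - exact: ltW.
  - by rewrite exprS ler_piMr// ltW.
  - by rewrite ler_weXn2l// ltnW.
have eT : 32 * K%:R ^+ 2 * q ^+ K <= expR (t / 8).
  apply: (le_trans small2); rewrite ler_expR -[_^-1]mul1r ler_pdivrMr.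
    by move: (ltW large); lra.
  by rewrite mulr_gt0// mulr_gt0.
apply: (@le_trans _ _ (4 * K%:R ^+ 2 * (8 * expR (t / 8)) * (expR (- (t / 4)) * q ^+ K))).
  have K2 : 0 <= 4 * K%:R ^+ 2 :> R by rewrite mulr_ge0// ltW.
  apply: ler_pM; last exact: ue.
  - by rewrite mulr_ge0// (mulr_ge0 K2 (ltW delta_gt0)).
  - exact: ltW.
  - rewrite -mulrA ler_wpM2l//.
    by apply: (le_trans _ te); rewrite -[leRHS]mul1r; exact: ler_wpM2r.
apply: (@le_trans _ _ (expR (t / 8) * (expR (t / 8) * expR (- (t / 4))))).
  have -> : 4 * K%:R ^+ 2 * (8 * expR (t / 8)) * (expR (- (t / 4)) * q ^+ K) =
    (32 * K%:R ^+ 2 * q ^+ K) * (expR (t / 8) * expR (- (t / 4))) by ring.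
  by rewrite ler_wpM2r// mulr_ge0// expR_ge0.
by rewrite -!expRD -[leRHS]expR0 ler_expR; lra.
Qed.

(** The left side is e (e q)^i. If e q <= 1 it is at most 1; otherwise it grows with [i] and is at
    most [u k t]. *)
Lemma mixed_power_le (i k : nat) t : (i <= k)%N -> 0 <= t ->
  e t ^+ i.+1 * q ^+ i <= u k t + 1.
Proof.
move=> ik t0; have e0 := ltW (e_gt0 t); have e1 := e_le1 t0.
have q0 := le_trans ler01 q1; have x0 : 0 <= e t * q by rewrite mulr_ge0.
rewrite /u !exprSr -!mulrA [e t * q ^+ i]mulrC [e t * q ^+ k]mulrC !mulrA -!exprMn.
have [x1|x1] := leP (e t * q) 1.
  apply: (@le_trans _ _ 1); last by rewrite lerDr mulr_ge0// exprn_ge0.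
  by rewrite mulr_ile1// ?exprn_ge0// exprn_ile1.
rewrite -[leLHS]addr0; apply: lerD => //.
by rewrite ler_wpM2r// ler_weXn2l// ltW.
Qed.

(** In u_i u_(k-i) the powers of e add up to k + 2 and those of q to k, so it is at most u_(k+1).
    The linear terms are covered by [mixed_power_le], and the four terms of the expansion account
    for the factor 4. *)
Lemma forcing_le (k i : nat) t (zi zj D : R) : (i <= k)%N -> 0 <= t ->
  0 <= D ->
  `|zi| <= D ^+ i.+1 * (u i t + 1) -> `|zj| <= D ^+ (k - i).+1 * (u (k - i) t + 1) ->
  `|zi * zj| <= 4 * D ^+ k.+2 * (u k.+1 t + 1).
Proof.
move=> ik t0 D0 hi hj.
have ji : (k - i <= k)%N by exact: leq_subr.
have q0 := le_trans ler01 q1.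
rewrite normrM; apply: (le_trans (ler_pM (normr_ge0 _) (normr_ge0 _) hi hj)).
have -> : D ^+ i.+1 * (u i t + 1) * (D ^+ (k - i).+1 * (u (k - i) t + 1)) =
    D ^+ (i.+1 + (k - i).+1) * (u i t * u (k - i) t + u i t + u (k - i) t + 1).
  by rewrite exprD; ring.
have -> : (i.+1 + (k - i).+1 = k.+2)%N by rewrite addSn addnS subnKC.
rewrite [leRHS](_ : _ = D ^+ k.+2 * (4 * (u k.+1 t + 1))); last by ring.
rewrite ler_wpM2l ?exprn_ge0//.
have uu : u i t * u (k - i) t <= u k.+1 t.
  rewrite /u mulrACA -!exprD addSn addnS subnKC//.
  rewrite ler_wpM2l ?exprn_ge0 ?(ltW (e_gt0 t))//.
  by rewrite ler_weXn2l.
have h1 : u i t <= u k.+1 t + 1 := mixed_power_le (leqW ik) t0.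
have h2 : u (k - i) t <= u k.+1 t + 1 := mixed_power_le (leqW ji) t0.
have u0 := u_gt0 k.+1 t.
by move: uu h1 h2 u0; move: (u i t) (u (k - i)%N t) (u k.+1 t) => x y z; lra.
Qed.

Lemma hierarchy_bound k : (k < n)%N -> forall t, 0 <= t ->
  `|g ^+ k * a k t| <= (2 * B) ^+ k.+1 * (u k t + 1).
Proof.
elim/ltn_ind: k => -[_ _ t t0|k IH kn t t0].
  rewrite expr0 mul1r a0// normr1.
  have u0 := u_gt0 0 t; have B2 : 1 <= (2 * B) ^+ 1 by rewrite expr1; move: B1; lra.
  by apply: mulr_ege1 => //; rewrite lerDr ltW.
have kK : (k.+1 < K)%N by exact: leq_trans nK.
have B0 : 0 <= B by exact: le_trans B1.
set C := 2 * B; have C0 : 0 <= C by rewrite mulr_ge0.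
set r := (4 * (p - 1))^-1.
pose w (t : R) := g ^+ k.+1 * a k.+1 t.
have hw := halfline_derivativeZ (g ^+ k.+1) (da kn).
rewrite -/r in hw.
pose m : R := k.+2%:R.
pose lambda := m * r * (p + 2 * k.+1%:R).
(* The forcing is at most [A * (u + 1)]. In [H] below, the secular term [A * t] produces [A * u],
   and [D] is chosen with m / 4 * D = A to produce the constant. *)
pose A := 2 * m * k.+1%:R * delta * C ^+ k.+2.
pose D := 8 * k.+1%:R * delta * C ^+ k.+2.
have p10 : 0 < p - 1 by rewrite subr_gt0.
have q0 : 0 <= q by exact: le_trans q1.
have d0 := ltW delta_gt0.
have m0 : 0 <= m by [].
have A0 : 0 <= A.
  by rewrite /A mulr_ge0 ?exprn_ge0// (mulr_ge0 _ d0)// mulr_ge0// mulr_ge0.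
have D0 : 0 <= D.
  by rewrite /D mulr_ge0 ?exprn_ge0// (mulr_ge0 _ d0)// mulr_ge0.
(* The true damping is at least the rate m / 4 built into [H]; as [H] is nonnegative, the surplus
   only helps the comparison. *)
have lambda_ge : m / 4 <= lambda.
  rewrite /lambda -mulrA ler_wpM2l//.
  have k1 : 1 <= k.+1%:R :> R by rewrite (ler_nat _ 1).
  have p40 : 0 < 4 * (p - 1) by rewrite mulr_gt0.
  rewrite /r mulrC ler_pdivlMr//; lra.
have hu : halfline_derivative (u k.+1) (fun t => - (m / 4) * u k.+1 t).
  apply: (halfline_derivative_eq (halfline_derivativeZ (q ^+ k.+1)
    (halfline_derivative_expR (- (m / 4))))) => s.
    rewrite /u /e mulrC -expRM_natl; congr (expR _ * _); rewrite /m; lra.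
  move=> _; rewrite /u /e -expRM_natl -/m mulrCA; congr (_ * _).
  rewrite mulrC; congr (expR _ * _); lra.
pose H (t : R) := u k.+1 t * (B ^+ k.+2 + A * t) + D.
have hH := halfline_derivativeD (halfline_derivativeM hu
  (halfline_derivativeD (halfline_derivative_cst (B ^+ k.+2))
    (halfline_derivativeZ A (@halfline_derivative_id R)))) (halfline_derivative_cst D).
have wH : forall t, 0 <= t -> `|w t| <= H t.
  apply: (halfline_comparison hw hH (lambda := lambda)).
    rewrite /H /w mulr0 addr0 /u /e mul0r oppr0 expR0 expr1n mul1r.
    rewrite normrM [`|g ^+ _|]ger0_norm ?exprn_ge0 ?(ltW g0)//.
    by move: (init kn) D0; rewrite /=; lra.
  move=> s s0; have sge0 := ltW s0; have us := ltW (u_gt0 k.+1 s).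
  rewrite /= add0r mulr1 addr0.
  have -> : g ^+ k.+1 * - (m * (r * ((p + 2 * k.+1%:R) * a k.+1 s +
      2 * \sum_(i < k.+1) a i s * a (k - i)%N s))) + lambda * w s =
    - (m / 2 * delta * \sum_(i < k.+1) (g ^+ i * a i s) * (g ^+ (k - i) * a (k - i)%N s)).
    have -> : \sum_(i < k.+1) (g ^+ i * a i s) * (g ^+ (k - i) * a (k - i)%N s) =
        g ^+ k * \sum_(i < k.+1) a i s * a (k - i)%N s.
      rewrite mulr_sumr; apply: eq_bigr => i _; rewrite mulrACA -exprD subnKC//.
      by rewrite -ltnS.
    rewrite /lambda /w /delta /r exprS; field.
    by rewrite gt_eqF.
  have md0 : 0 <= m / 2 * delta by rewrite (mulr_ge0 _ d0)// mulr_ge0.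
  rewrite normrN normrM (ger0_norm md0).
  apply: (@le_trans _ _ (m / 2 * delta * (k.+1%:R * (4 * C ^+ k.+2 * (u k.+1 s + 1))))).
    rewrite ler_wpM2l//.
    apply: (le_trans (ler_norm_sum _ _ _)).
    rewrite mulr_natl -[X in _ *+ X]card_ord -sumr_const; apply: ler_sum => i _.
    have ik : (i <= k)%N by rewrite -ltnS.
    have jk : (k - i <= k)%N by exact: leq_subr.
    apply: (forcing_le ik sge0 C0).
      exact: IH (leq_ltn_trans ik (ltnSn k)) (leq_ltn_trans ik (ltnW kn)) _ sge0.
    exact: IH (leq_ltn_trans jk (ltnSn k)) (leq_ltn_trans jk (ltnW kn)) _ sge0.
  have HA : 0 <= H s.
    by rewrite /H addr_ge0// mulr_ge0// addr_ge0 ?exprn_ge0// mulr_ge0.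
  have : m / 4 * H s <= lambda * H s by rewrite ler_wpM2r.
  rewrite -/(H s) /H /A /D; lra.
apply: (le_trans (wH t t0)); rewrite /H.
(* Budget for C^(k+2) (u + 1): the initial datum takes u / 2, thanks to C = 2 B, the secular term
   takes (u + 1) / 2 and the constant [D] takes 1 / 2. *)
have BC : B ^+ k.+2 <= C ^+ k.+2 / 2.
  rewrite /C exprMn ler_pdivlMr// mulrC ler_wpM2r ?exprn_ge0//.
  by rewrite exprS ler_peMr// exprn_ege1// ler1n.
have grow := time_growth_bound kK t0.
have u0 := u_gt0 k.+1 t.
have KR : k.+2%:R <= K%:R :> R by rewrite ler_nat.
have K1R : k.+1%:R <= k.+2%:R :> R by rewrite ler_nat.
have Au : A * t * u k.+1 t <= C ^+ k.+2 * ((u k.+1 t + 1) / 2).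
  apply: (le_trans _ (ler_wpM2l (exprn_ge0 k.+2 C0) grow)).
  have mk : m * k.+1%:R <= K%:R ^+ 2.
    by rewrite expr2; apply: ler_pM => //; exact: le_trans KR.
  have X0 : 0 <= 2 * delta * t * u k.+1 t * C ^+ k.+2.
    rewrite mulr_ge0 ?exprn_ge0// (mulr_ge0 _ (ltW u0))// mulr_ge0//.
    by rewrite (mulr_ge0 _ d0).
  by have := ler_wpM2r X0 mk; rewrite /A; lra.
have Dle : D <= C ^+ k.+2 / 2.
  have kd : k.+1%:R * delta <= K%:R * delta.
    by apply: ler_wpM2r => //; exact: le_trans KR.
  have kd2 : 8 * k.+1%:R * delta <= 1 / 2 by move: kd small1; lra.
  by have := ler_wpM2r (exprn_ge0 k.+2 C0) kd2; rewrite /D; lra.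
have := ler_wpM2l (ltW u0) BC.
lra.
Qed.

End hierarchy_bound.

(** * Threshold for N and assembly of the final bound *)

Lemma large_N_threshold (R : realType) (alpha c : R) (K : nat) :
  alpha < 1 -> 0 <= c -> (0 < K)%N ->
  exists N0 : nat, (2 <= N0)%N /\ forall N : nat, (N0 <= N)%N ->
    16 * K%:R * (N%:R `^ alpha / (N%:R - 1)) <= 1 :> R /\
    32 * K%:R ^+ 2 * (N%:R `^ c) ^+ K <=
      expR (32 * K%:R ^+ 2 * (N%:R `^ alpha / (N%:R - 1)))^-1.
Proof.
move=> alpha1 c0 K0.
have Kp : 0 < K%:R :> R by rewrite ltr0n.
(* Chosen so that x = N^(1 - alpha), for which delta x = N / (N - 1) <= 2, satisfies q^K N <= x^m.
   The successor makes [m] positive, as needed for m-th roots and for the Taylor term of order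
   [m]. *)
pose m := (Num.bound ((c * K%:R + 1) / (1 - alpha))).+1.
have mge : c * K%:R + 1 <= (1 - alpha) * m%:R.
  rewrite [leRHS]mulrC -ler_pdivrMr ?subr_gt0//.
  have ge0 : 0 <= (c * K%:R + 1) / (1 - alpha).
    by apply: divr_ge0; [rewrite addr_ge0// mulr_ge0// ltW|rewrite subr_ge0 ltW].
  by apply: (le_trans (ltW (archi_boundP ge0))); rewrite ler_nat.
(* [T1] is what remains of the second inequality once exp(x / (64 K^2)) is bounded below by its
   Taylor term of order [m]; [T2 <= N <= x ^+ m] yields 32 K <= x for the first. *)
pose T1 : R := 32 * K%:R ^+ 2 * ((64 * K%:R ^+ 2) ^+ m * m`!%:R).
pose T2 : R := (32 * K%:R) ^+ m.
exists (2 + Num.bound T1 + Num.bound T2)%N; split; first by rewrite -addnA leq_addr.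
move=> N NN0.
have N2 : 2 <= N%:R :> R by rewrite (ler_nat R 2); lia.
have K2 : 0 < K%:R ^+ 2 :> R by rewrite exprn_gt0.
have T10 : 0 <= T1.
  have c32 : 0 <= 32 * K%:R ^+ 2 :> R by rewrite mulr_ge0// ltW.
  have c64 : 0 <= 64 * K%:R ^+ 2 :> R by rewrite mulr_ge0// ltW.
  by rewrite /T1 (mulr_ge0 c32)// mulr_ge0// exprn_ge0.
have T20 : 0 <= T2 by rewrite exprn_ge0// mulr_ge0// ltW.
have T1N : T1 <= N%:R by apply: (le_trans (ltW (archi_boundP T10))); rewrite ler_nat; lia.
have T2N : T2 <= N%:R by apply: (le_trans (ltW (archi_boundP T20))); rewrite ler_nat; lia.
have Np : 0 < N%:R :> R by lra.
set delta := _ / _; set q := _ `^ c.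
pose x : R := N%:R `^ (1 - alpha).
have x0 : 0 < x by rewrite powR_gt0.
have d0 : 0 < delta by rewrite divr_gt0 ?powR_gt0//; lra.
have dx : delta * x <= 2.
  rewrite /delta mulrAC -powRD; last by apply/implyP => _; rewrite gt_eqF.
  rewrite (_ : alpha + (1 - alpha) = 1); last by ring.
  by rewrite powRr1 ?(ltW Np)// ler_pdivrMr; lra.
have q1 : 1 <= q.
  by rewrite -(powRr0 N%:R) ler_powR//; lra.
have qK1 : 1 <= q ^+ K by rewrite exprn_ege1.
have xm : q ^+ K * N%:R <= x ^+ m.
  rewrite -!powR_mulrn ?powR_ge0// -!powRrM -{2}(powRr1 (ltW Np)) -powRD.
    by apply: ler_powR => //; lra.
  by apply/implyP => _; rewrite gt_eqF.
have xN : N%:R <= x ^+ m by apply: (le_trans _ xm); rewrite ler_peMl// ltW.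
split.
  have x32 : 32 * K%:R <= x.
    have k32 : 0 <= 32 * K%:R :> R by rewrite mulr_ge0// ltW.
  by have := le_trans T2N xN; rewrite /T2 ler_pXn2r ?nnegrE// ltW.
  rewrite -(ler_pM2r x0) mul1r; apply: (le_trans _ x32).
  have := ler_wpM2l (ltW Kp) dx; lra.
set y := (32 * K%:R ^+ 2 * delta)^-1.
have c64 : 0 < 64 * K%:R ^+ 2 :> R by rewrite mulr_gt0.
have xy : x / (64 * K%:R ^+ 2) <= y.
  rewrite /y -[leRHS]mul1r ler_pdivlMr; last by rewrite mulr_gt0// mulr_gt0.
  rewrite mulrAC ler_pdivrMr// mul1r.
  have := ler_wpM2l (ltW K2) dx; lra.
have z0 : 0 <= x / (64 * K%:R ^+ 2) by rewrite divr_ge0// ltW.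
apply: (@le_trans _ _ (expR (x / (64 * K%:R ^+ 2)))); last by rewrite ler_expR.
apply: (@le_trans _ _ ((x / (64 * K%:R ^+ 2)) ^+ m / m`!%:R)); last first.
  have := @expR_ge1Dxn _ _ m.-1 z0; rewrite -/m; lra.
have mf : 0 < m`!%:R :> R by rewrite ltr0n fact_gt0.
rewrite ler_pdivlMr// expr_div_n ler_pdivlMr ?exprn_gt0//.
apply: (le_trans _ xm).
have -> : 32 * K%:R ^+ 2 * q ^+ K * m`!%:R * (64 * K%:R ^+ 2) ^+ m = q ^+ K * T1.
  rewrite /T1; ring.
by rewrite ler_wpM2l// (le_trans ler01).
Qed.

Theorem proposition2p17 (R : realType) :
  exists C : R -> R,
    (forall B : R, 1 <= B -> 1 <= C B) /\
    forall (alpha c : R) (nstar : nat),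
      0 < alpha -> alpha < 1 -> 0 <= c ->
      exists N0 : nat, (2 <= N0)%N /\
        forall N : nat, (N0 <= N)%N ->
        forall F : R -> probability (borel_rV R N) R,
          kac_evolution F ->
          symmetric_law (F 0) ->
          radon_measure (F 0) ->
        forall B : R, 1 <= B ->
          (forall (n : nat) (le_nN : (n <= N)%N), (1 <= n <= nstar)%N ->
             (`|nr_cumulant (F 0) le_nN|
                * N%:R `^ ((alpha - c) * (n%:R - 1)) / (n.-1)`!%:R)
               `^ (n%:R^-1) <= B) ->
        forall (n : nat) (le_nN : (n <= N)%N), (1 <= n <= nstar)%N ->
        forall t : R, 0 <= t ->
          N%:R `^ (alpha * (n%:R - 1)) * `|nr_cumulant (F t) le_nN|
          <= C B ^+ n * (n.-1)`!%:R
             * (expR (- (n%:R / 4) * t) * N%:R `^ (c * (n%:R - 1)) + 1).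
Proof.
exists (fun B => 2 * B); split=> [B B1|alpha c nstar alpha0 alpha1 c0]; first lra.
(* The order [nstar.+1] is positive even when [nstar] is 0, as the threshold requires. *)
have [N0 [N02 thr]] := large_N_threshold alpha1 c0 (ltn0Sn nstar).
exists N0; split => // N NN0 F evF symF _ B B1 init n le_nN /andP[n0 nn] t t0.
have [small1 small2] := thr N NN0.
have N1 : (1 < N)%N by exact: leq_trans NN0.
have N1R : 1 < N%:R :> R by rewrite (ltr_nat R 1).
have Np : 0 < N%:R :> R by exact: lt_trans N1R.
have powE (s : R) k : N%:R `^ (s * (k.+1%:R - 1)) = (N%:R `^ s) ^+ k.
  by rewrite -nat1r addrAC subrr add0r powRrM powR_mulrn ?powR_ge0.
have q1 : 1 <= N%:R `^ c by rewrite -[leLHS](powRr0 N%:R) ler_powR// ltW.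
have g0 : 0 < N%:R `^ alpha by rewrite powR_gt0.
have HB := @hierarchy_bound R N%:R (N%:R `^ alpha) (N%:R `^ c) B nstar.+1 n
  (fun k t => log_deriv_coef (moment_coef F t) k) N1R g0 q1 B1 (leqW nn) small1 small2.
have {}HB := HB (log_deriv_moment0 N1 evF symF).
have {}HB := HB (fun k kn => log_deriv_moment_derivative N1 evF symF
  (leq_trans kn le_nN)).
(* The hypothesis bounds a root of order k + 1. Raising it to that power and splitting N^alpha =
   N^(alpha - c) N^c gives the initial bound of the hierarchy. *)
have hinit k : (k < n)%N -> `|log_deriv_coef (moment_coef F 0) k| * (N%:R `^ alpha) ^+ k
    <= B ^+ k.+1 * (N%:R `^ c) ^+ k.
  move=> kn; have kN : (k < N)%N by exact: leq_trans le_nN.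
  have := init k.+1 kN (leq_trans kn nn).
  have fk : 0 < k`!%:R :> R by rewrite ltr0n fact_gt0.
  rewrite (nr_cumulantE N1 evF symF kN (lexx 0))//= powE normrM [`|k`!%:R|]ger0_norm ?(ltW fk)//.
  rewrite mulrAC mulrK ?unitfE ?gt_eqF//.
  set Y := _ * _ => YB.
  have Y0 : 0 <= Y by rewrite mulr_ge0// exprn_ge0// powR_ge0.
  have YBk : Y <= B ^+ k.+1.
    have -> : Y = (Y `^ k.+1%:R^-1) ^+ k.+1.
      by rewrite -powR_mulrn ?powR_ge0// -powRrM mulVf ?powRr1// pnatr_eq0.
    by apply: lerXn2r => //; rewrite nnegrE ?powR_ge0 ?(le_trans ler01).
  have gE : N%:R `^ alpha = N%:R `^ (alpha - c) * N%:R `^ c.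
    by rewrite -powRD ?subrK//; apply/implyP => _; rewrite gt_eqF.
  rewrite gE exprMn mulrA; apply: ler_wpM2r => //.
have {}HB := HB hinit.
case: n n0 nn le_nN HB hinit => // k _ kn kN HB _.
rewrite (nr_cumulantE N1 evF symF kN t0)//= !powE.
have fk : 0 < k`!%:R :> R by rewrite ltr0n fact_gt0.
rewrite normrM [`|k`!%:R|]ger0_norm ?(ltW fk)// mulrA.
rewrite [leRHS]mulrAC ler_pM2r//.
have -> : expR (- (k.+1%:R / 4) * t) = expR (- (t / 4)) ^+ k.+1.
  by rewrite -expRM_natl; congr expR; lra.
have := HB k (ltnSn k) t t0.
by rewrite normrM [`|(N%:R `^ alpha) ^+ k|]ger0_norm ?exprn_ge0 ?(ltW g0).
Qed.
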